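(* For the MH dynamics (with $\Gamma=2K+2$), the following hold. (1) For distinct spins $a,b\in S$, $\mathcal E^a\cap\mathcal E^b=\emptyset$. (2) For distinct spins $a,b\in S$, $\mathcal E^a\cap\mathcal B^{a,b}=\mathcal R_2^{a,b}$. (3) For three distinct spins $a,b,c\in S$, $\mathcal E^a\cap\mathcal B^{b,c}=\emptyset$. (4) $\mathcal E\cup\mathcal B=\widehat{\mathcal N}(\mathcal S)$.
   Context: Fix integers $K,L$ with $11\le K\le L$ and $q\ge2$. Let $\Lambda=\mathbb T_K\times\mathbb T_L$, $\mathbb T_n=\mathbb Z/n\mathbb Z$ (nearest-neighbor relation $x\sim y$), $S=\{1,\dots,q\}$, $\mathcal X=S^\Lambda$, $H(\sigma)=\sum_{\{x,y\}\subset\Lambda,x\sim y}\mathbf 1\{\sigma(x)\ne\sigma(y)\}$. $\mathbf a$ is the configuration with all spins $a$; $\mathcal S=\{\mathbf1,\dots,\mathbf q\}$. $\Gamma=2K+2$. For $m\le n$, $\llbracket m,n\rrbracket=[m,n]\cap\mathbb Z$. Paths (MH dynamics): a path is a sequence $\omega=(\omega_n)_{n=0}^N$ in $\mathcal X$ such that $\omega_n$ and $\omega_{n+1}$ differ at exactly one site for each $n$. Its height is $\Phi_\omega=\max_{0\le n\le N}H(\omega_n)$. $\Phi(\eta,\xi)$ is the minimum of $\Phi_\omega$ over paths from $\eta$ to $\xi$. $\widehat{\mathcal N}(\eta)=\{\xi:\Phi(\eta,\xi)\le\Gamma\}$ and $\widehat{\mathcal N}(\mathcal P)=\bigcup_{\eta\in\mathcal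 P}\widehat{\mathcal N}(\eta)$. For $\mathcal Q\subseteq\mathcal X$ and $\eta\notin\mathcal Q$, $\widehat{\mathcal N}(\eta;\mathcal Q)$ is the set of $\xi$ for which there is a path $\omega$ from $\eta$ to $\xi$ contained in $\mathcal X\setminus\mathcal Q$ with $\Phi_\omega\le\Gamma$. Regular and canonical configurations: let $a\neq b$ in $S$. For $\ell\in\mathbb T_L$, $v\in\llbracket0,L\rrbracket$, $\xi^{a,b}_{\ell,v}$ has spin $b$ on $\mathbb T_K\times\{\ell+n:n\in\llbracket0,v-1\rrbracket\}$ and $a$ elsewhere. For $v\in\llbracket0,L-1\rrbracket$, $k\in\mathbb T_K$, $h\in\llbracket0,K\rrbracket$, $\xi^{a,b,+}_{\ell,v;k,h}$ (resp. $\xi^{a,b,-}_{\ell,v;k,h}$) has spin $b$ exactly on the $b$-sites of $\xi^{a,b}_{\ell,v}$ together with $\{k+n:n\in\llbracket0,h-1\rrbracket\}\times\{\ell+v\}$ (resp. $\times\{\ell-1\}$), and $a$ elsewhere. Set $$\widetilde{\mathcal R}_v^{a,b}=\{\xi^{a,b}_{\ell,v}:\ell\in\mathbb T_L\},\quad \widetilde{\mathcal Q}_v^{a,b}=\{\xi^{a,b,\pm}_{\ell,v;k,h}:\ell\in\mathbb T_L,k\in\mathbb T_K,h\in\llbracket1,K-1\rrbracket\}.$$ If $K<L$, $\mathcal R_v^{a,b}=\widetilde{\mathcal R}_v^{a,b}$, $\mathcal Q_v^{a,b}=\widetilde{\mathcal Q}_v^{a,b}$. If $K=L$, $\mathcal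 R_v^{a,b}=\widetilde{\mathcal R}_v^{a,b}\cup\Theta(\widetilde{\mathcal R}_v^{a,b})$ and $\mathcal Q_v^{a,b}=\widetilde{\mathcal Q}_v^{a,b}\cup\Theta(\widetilde{\mathcal Q}_v^{a,b})$, with $\Theta$ the transpose $(\Theta\sigma)(k,\ell)=\sigma(\ell,k)$. Typical configurations: $$\mathcal B^{a,b}=\bigcup_{v\in\llbracket2,L-2\rrbracket}\mathcal R_v^{a,b}\cup\bigcup_{v\in\llbracket2,L-3\rrbracket}\mathcal Q_v^{a,b},\qquad \mathcal B=\bigcup_{a\ne b}\mathcal B^{a,b},\qquad \mathcal B_\Gamma=\bigcup_{a\ne b}\bigcup_{v\in\llbracket2,L-3\rrbracket}\mathcal Q_v^{a,b},$$ $$\mathcal E^a=\widehat{\mathcal N}(\mathbf a;\mathcal B_\Gamma),\qquad \mathcal E=\bigcup_{a\in S}\mathcal E^a .$$ *)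

(* Defs.v *)
(* Mathematical Components, with classical sets from MathComp-Analysis. *)
From HB Require Import structures.
From mathcomp Require Import all_boot all_order all_algebra.
From mathcomp Require Import boolp classical_sets.

Set Implicit Arguments.
Unset Strict Implicit.
Unset Printing Implicit Defensive.

Import GRing.Theory.

(* 'Z_n is the ring Z/nZ only for 1 < n. *)
Definition site (K L : nat) : finType := ('Z_K * 'Z_L)%type.

Definition adj (K L : nat) : rel (site K L) := fun x y =>
  ((x.1 == y.1) && ((y.2 == x.2 + 1) || (x.2 == y.2 + 1))
   || (x.2 == y.2) && ((y.1 == x.1 + 1) || (x.1 == y.1 + 1)))%R.

Definition edges (K L : nat) : {set {set site K L}} :=
  [set e : {set site K L} |
    [exists x : site K L, exists y : site K L,
      adj x y && (e == [set x; y])]].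

(* 'I_q stands for the spin set {1, ..., q}. *)
Definition config (K L q : nat) : finType := {ffun site K L -> 'I_q}.

Definition H (K L q : nat) (s : config K L q) : nat :=
  \sum_(e in edges K L) [exists x in e, exists y in e, s x != s y].

Definition Gam (K : nat) : nat := 2 * K + 2.

Definition mono (K L q : nat) (a : 'I_q) : config K L q := [ffun => a].

Definition step (K L q : nat) : rel (config K L q) := fun s t =>
  #|[set x | s x != t x]| == 1.

(* The sequence w_0, ..., w_N is represented by its head w_0 and the list p of
   the remaining terms, as in [path]. *)
Definition is_path (K L q : nat) (s t : config K L q)
    (p : seq (config K L q)) : Prop :=
  path (@step K L q) s p /\ last s p = t.

Definition height (K L q : nat) (s : config K L q)
    (p : seq (config K L q)) : nat := \max_(u <- s :: p) H u.

Lemma path_exists (K L q : nat) (s t : config K L q) :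
  exists p, is_path s t p.
Proof.
move: {2}#|_| (erefl #|[set x | s x != t x]%SET|) => n.
elim: n s => [|n IHn] s hn.
  exists [::]; split => //=; apply/ffunP => x; apply/eqP.
  have /setP/(_ x) := cards0_eq hn.
  by rewrite !inE => /negbFE.
have /card_gt0P[x] : 0 < #|[set x | s x != t x]%SET| by rewrite hn.
rewrite inE => sx.
pose s' : config K L q := [ffun y => if y == x then t x else s y].
have [|p [hp lp]] := IHn s'.
  move: hn; rewrite (cardsD1 x) inE sx add1n => -[<-].
  apply: eq_card => y; rewrite !inE ffunE.
  by case: (y =P x) => [->|_] //; rewrite eqxx.
exists (s' :: p); split => //=; rewrite hp andbT.
rewrite /step (_ : [set y | _]%SET = [set x]%SET) ?cards1 //.
apply/setP => y; rewrite !inE ffunE.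
by case: (y =P x) => [->|_] //; rewrite eqxx.
Qed.

Lemma height_exists (K L q : nat) (s t : config K L q) :
  exists n, `[< exists p, is_path s t p /\ height s p = n >].
Proof.
by have [p hp] := path_exists s t; exists (height s p); apply/asboolP; exists p.
Qed.

Definition Phi (K L q : nat) (s t : config K L q) : nat :=
  ex_minn (height_exists s t).

Definition strip (K L q : nat) (a b : 'I_q) (l : 'Z_L) (v : nat) :
    config K L q :=
  [ffun x : site K L => if [exists n : 'I_v, x.2 == (l + n%:R)%R] then b else a].

Definition strip_plus (K L q : nat) (a b : 'I_q) (l : 'Z_L) (v : nat)
    (k : 'Z_K) (h : nat) : config K L q :=
  [ffun x : site K L =>
    if [exists n : 'I_v, x.2 == (l + n%:R)%R]
       || [exists n : 'I_h, x.1 == (k + n%:R)%R] && (x.2 == (l + v%:R)%R)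
    then b else a].

Definition strip_minus (K L q : nat) (a b : 'I_q) (l : 'Z_L) (v : nat)
    (k : 'Z_K) (h : nat) : config K L q :=
  [ffun x : site K L =>
    if [exists n : 'I_v, x.2 == (l + n%:R)%R]
       || [exists n : 'I_h, x.1 == (k + n%:R)%R] && (x.2 == (l - 1)%R)
    then b else a].

(* The transpose, used only when K = L; [inZp] then acts as the identity and
   merely converts between the types 'Z_K and 'Z_L. *)
Definition transp (K L q : nat) (s : config K L q) : config K L q :=
  [ffun x : site K L => s (inZp x.2, inZp x.1)].

Local Open Scope classical_set_scope.

Definition Nhat (K L q : nat) (s : config K L q) : set (config K L q) :=
  [set t | Phi s t <= Gam K].

Definition Nhat_set (K L q : nat) (P : set (config K L q)) :
    set (config K L q) := \bigcup_(s in P) Nhat s.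

Definition Nhat_avoid (K L q : nat) (s : config K L q)
    (Q : set (config K L q)) : set (config K L q) :=
  [set t | exists p, [/\ is_path s t p,
                         forall u, u \in s :: p -> ~ Q u
                       & height s p <= Gam K]].

Definition Rtilde (K L q : nat) (a b : 'I_q) (v : nat) : set (config K L q) :=
  [set s | exists l : 'Z_L, s = strip K a b l v].
Arguments Rtilde K L {q} a b v.

Definition Qtilde (K L q : nat) (a b : 'I_q) (v : nat) : set (config K L q) :=
  [set s | exists (l : 'Z_L) (k : 'Z_K) (h : nat), 1 <= h <= K - 1 /\
    (s = strip_plus a b l v k h \/ s = strip_minus a b l v k h)].
Arguments Qtilde K L {q} a b v.

Definition Rset (K L q : nat) (a b : 'I_q) (v : nat) : set (config K L q) :=
  if K == L then Rtilde K L a b v `|` @transp K L q @` Rtilde K L a b v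
  else Rtilde K L a b v.
Arguments Rset K L {q} a b v.

Definition Qset (K L q : nat) (a b : 'I_q) (v : nat) : set (config K L q) :=
  if K == L then Qtilde K L a b v `|` @transp K L q @` Qtilde K L a b v
  else Qtilde K L a b v.
Arguments Qset K L {q} a b v.

Definition Bpair (K L q : nat) (a b : 'I_q) : set (config K L q) :=
  (\bigcup_(v in [set v : nat | 2 <= v <= L - 2]) Rset K L a b v)
  `|` (\bigcup_(v in [set v : nat | 2 <= v <= L - 3]) Qset K L a b v).
Arguments Bpair K L {q} a b.

Definition Ball (K L q : nat) : set (config K L q) :=
  \bigcup_(ab in [set ab : 'I_q * 'I_q | ab.1 != ab.2]) Bpair K L ab.1 ab.2.
Arguments Ball K L q : clear implicits.

Definition BGam (K L q : nat) : set (config K L q) :=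
  \bigcup_(ab in [set ab : 'I_q * 'I_q | ab.1 != ab.2])
    \bigcup_(v in [set v : nat | 2 <= v <= L - 3]) Qset K L ab.1 ab.2 v.
Arguments BGam K L q : clear implicits.

Definition Espin (K L q : nat) (a : 'I_q) : set (config K L q) :=
  Nhat_avoid (mono K L a) (BGam K L q).
Arguments Espin K L {q} a.

Definition Eall (K L q : nat) : set (config K L q) :=
  \bigcup_(a in [set: 'I_q]) Espin K L a.
Arguments Eall K L q : clear implicits.

Definition ground (K L q : nat) : set (config K L q) :=
  range (@mono K L q).
Arguments ground K L q : clear implicits.

(* Main.v *)
Require Import Defs.
From mathcomp Require Import all_boot all_order all_algebra.
From mathcomp Require Import boolp classical_sets.
From mathcomp Require Import zify.

(** Why the theorem holds.

    The energy of a configuration is the number of colour changes met along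
    all the rows and columns of the torus, read cyclically
    ([energy_lines]); a line that is not monochromatic carries at least two
    changes, and carries exactly two only if it consists of two arcs of two
    colours ([cuts2_arc]).  The budget 2K + 2 is therefore so small that a
    configuration with one row full of [a] and one row full of [b] is rigid:
    the K columns already cost 2K, what remains pays for one broken row at
    most, and the configuration is a strip or a strip with a bar attached
    ([full_rows_strip]).  Every other statement rests on this
    classification and on counting spins.

    Separation of the valleys.  Put m = K t + 1 with t about K / 2.  A
    configuration of energy at most 2K + 2 with exactly m spins different
    from [a] lies in [BGam] ([critical_BGam]).  Indeed, call a line mixed
    if it contains [a] and something else; there are at most K + 1 mixed
    lines.  If neither a row nor a column direction shows both a line full
    of [a] and a line free of [a], then the sites that are [a], or those
    that are not, sit in the product of the mixed columns by the mixed rows,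
    which has at most (K + 1)^2 / 4 elements, too few in both cases.
    Otherwise the classification applies, and the count m, which is 1 modulo
    K, forces a strip of width t with a bar of length 1.  As one flip changes
    the number of spins [a] by at most one, a path from the configuration
    all [a] that avoids [BGam] never gets down to K L - m spins [a]
    ([Espin_cnt]).  As 2m <= K L, two such valleys cannot meet.

    Strips.  Filling the torus site by site, row after row, gives paths of
    height at most 2K + 2 from a constant configuration to every strip and
    every strip with a bar ([oriented_reach]); up to width 2 they have too
    few spins of the second colour to meet [BGam] ([R2_Espin]).  After one
    flip, a configuration of [Bpair] still has a full row of both colours, so
    the classification describes its neighbours too ([Bpair_neighbour]).
    Counting then shows that a strip of width between 3 and L - 3 is
    surrounded by [BGam] ([R_isolated]), and that the union of the valleys
    and of the canonical configurations is closed under admissible flips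
    ([Nhat_closed]). *)

Set Implicit Arguments.
Unset Strict Implicit.
Unset Printing Implicit Defensive.

Import GRing.Theory.

(** * Arithmetic and colour changes on a cycle *)

Lemma Zp_lt (n : nat) (x : 'Z_n) : 1 < n -> x < n.
Proof. by move=> n1; rewrite -[X in _ < X](Zp_cast n1). Qed.

Lemma val_natZp (n m : nat) : 1 < n -> m < n -> (m%:R : 'Z_n)%R = m :> nat.
Proof. by move=> n1 mn; rewrite val_Zp_nat // modn_small. Qed.

(** Sums and differences in 'Z_n are given by case analysis rather than by a
    remainder, so that linear arithmetic can finish the computations. *)
Lemma val_addZp (n : nat) (x y : 'Z_n) : 1 < n ->
  (x + y)%R = (if x + y < n then x + y else x + y - n) :> nat.
Proof.
move=> n1; have xn := Zp_lt x n1; have yn := Zp_lt y n1.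
transitivity ((x + y) %% n); first by congr (_ %% _); apply: Zp_cast.
case: ltnP => h; first by rewrite modn_small.
rewrite -[X in X %% _](subnK h) modnDr modn_small //; lia.
Qed.

Lemma val_subZp (n : nat) (x y : 'Z_n) : 1 < n ->
  (x - y)%R = (if y <= x then x - y else x + n - y) :> nat.
Proof.
move=> n1; have := val_addZp (x - y)%R y n1; rewrite subrK.
have := Zp_lt x n1; have := Zp_lt y n1; have := Zp_lt (x - y)%R n1.
move: (nat_of_ord (x - y)%R) (nat_of_ord x) (nat_of_ord y) => a b c.
case: ifP; case: ifP; lia.
Qed.

Lemma val_oneZp (n : nat) : 1 < n -> (1 : 'Z_n)%R = 1 :> nat.
Proof. by move=> n1; apply: (val_natZp n1 (m := 1)). Qed.

Lemma Zp_propagate (n : nat) (P : pred 'Z_n) (x : 'Z_n) :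
  P x -> (forall y, P y -> P (y + 1)%R) -> forall y, P y.
Proof.
move=> Px Pstep y; rewrite -(subrK x y) addrC -(natr_Zp (y - x)%R).
elim: (nat_of_ord _) => [|m IH]; first by rewrite addr0.
by rewrite -natr1 addrA; apply: Pstep.
Qed.

Definition cuts (n : nat) (T : eqType) (f : 'Z_n -> T) : {set 'Z_n} :=
  [set i | f i != f (i + 1)%R]%SET.

Definition ncuts (n : nat) (T : eqType) (f : 'Z_n -> T) : nat := #|cuts f|.

Lemma cyclic_entry (n : nat) (P : pred 'Z_n) (x y : 'Z_n) :
  P x -> ~~ P y -> exists i, ~~ P i /\ P (i + 1)%R.
Proof.
move=> Px Py.
have [i /andP[h1 h2]|h] := pickP (fun i => ~~ P i && P (i + 1)%R).
  by exists i.
suff : ~~ P x by rewrite Px.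
apply: (@Zp_propagate n (fun i => ~~ P i) y) => // z Pz.
by have := h z; rewrite Pz /= => ->.
Qed.

(** A value that is taken and missed is entered once and left once on the
    way round; these two changes are the source of every lower bound on the
    energy. *)
Lemma entry_exit (n : nat) (T : eqType) (f : 'Z_n -> T) (x y : 'Z_n) :
  f x != f y -> exists i j, [/\ i != j, [set i; j]%SET \subset cuts f,
    f i != f x, f (i + 1)%R = f x & f j = f x /\ f (j + 1)%R != f x].
Proof.
move=> fxy.
have [|i [i1 /eqP i2]] := @cyclic_entry n (fun z => f z == f x) x y (eqxx _).
  by rewrite eq_sym.
have [||j [j1 j2]] := @cyclic_entry n (fun z => f z != f x) y x.
- by rewrite eq_sym.
- by rewrite eqxx.
rewrite negbK in j1; move/eqP: j1 => j1.
exists i, j; split => //; first by apply: contraNneq i1 => ->; rewrite j1.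
apply/fintype.subsetP => z; rewrite !inE => /orP[]/eqP->; first by rewrite i2.
by rewrite j1 eq_sym.
Qed.

Lemma cuts_ge2 (n : nat) (T : eqType) (f : 'Z_n -> T) (x y : 'Z_n) :
  f x != f y -> 1 < ncuts f.
Proof.
move=> /entry_exit[i [j [ij /subset_leq_card]]].
by rewrite cards2 ij.
Qed.

Lemma cuts_le1_const (n : nat) (T : eqType) (f : 'Z_n -> T) :
  ncuts f <= 1 -> forall x y, f x = f y.
Proof.
move=> h x y; apply/eqP; apply: contraLR h => /cuts_ge2.
by rewrite -ltnNge.
Qed.

(** Past the entry into the value [f x], the function can change only at the
    exit from it, so it keeps that value on an arc and a single value off the
    arc. *)
Lemma cuts2_arc (n : nat) (T : eqType) (f : 'Z_n -> T) (x y : 'Z_n) :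
  1 < n -> f x != f y -> ncuts f <= 2 ->
  exists (l : 'Z_n) (v : nat), 1 <= v < n /\
    forall i, f i = if (i - l)%R < v then f x else f y.
Proof.
move=> n1 fxy c2; have [e [o [eo sub fe fe1 [fo fo1]]]] := entry_exit fxy.
have defc : cuts f = [set e; o]%SET.
  by apply/eqP; rewrite eq_sym eqEcard sub cards2 eo.
have nocut i : i != e -> i != o -> f (i + 1)%R = f i.
  move=> ie io; apply/esym/eqP; have : i \notin cuts f.
    by rewrite defc !inE negb_or ie io.
  by rewrite inE negbK.
(* [e + 1] is the first site of the arc and [o] its last one. *)
pose v := nat_of_ord (o - e)%R.
have vn : v < n by apply: Zp_lt.
have v1 : 1 <= v.
  rewrite lt0n; apply: contra eo => /eqP h; rewrite eq_sym -subr_eq0.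
  exact/eqP/val_inj.
have eE m : m < n -> (e + m%:R == e)%R -> m = 0.
  move=> mn /eqP; rewrite -[RHS]addr0 => /addrI/(congr1 (@nat_of_ord _)).
  by rewrite val_natZp.
have oE m : m < n -> (e + m%:R == o)%R -> m = v.
  move=> mn /eqP h; rewrite /v -h addrC addKr.
  by rewrite val_natZp.
(* Away from [e] and [o], moving on does not change the value. *)
have walk m : 0 < m < n -> m != v -> f (e + m.+1%:R)%R = f (e + m%:R)%R.
  move=> /andP[m0 mn] mv; rewrite -natr1 addrA; apply: nocut.
    by apply: contraTneq m0 => /eqP/eE -> //.
  by apply: contraNneq mv => /eqP/oE -> //.
have fin m : 0 < m <= v -> f (e + m%:R)%R = f x.
  elim: m => [|[|m] IH] // /andP[_ mv].
  by rewrite walk ?IH //; lia.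
have fout m : v < m <= n -> f (e + m%:R)%R = f (o + 1)%R.
  elim: m => [|m IH] // /andP[vm mn].
  case: (ltngtP v m) => h.
  - by rewrite walk ?IH //; lia.
  - lia.
  - by rewrite -natr1 addrA -h /v natr_Zp [(e + _)%R]addrC subrK.
have fE i : f i = if (i - (e + 1))%R < v then f x else f (o + 1)%R.
  have -> : (i - (e + 1) = (i - e) - 1)%R by rewrite opprD addrA.
  rewrite val_subZp // val_oneZp //.
  have lt := Zp_lt (i - e)%R n1.
  have {1}-> : i = (e + (nat_of_ord (i - e)%R)%:R)%R by rewrite natr_Zp addrC subrK.
  case: (posnP (i - e)%R) => [->|i0].
    (* [e] itself is reached as [e + n], at the end of the turn. *)
    rewrite /= add0n ifF; last lia.
    by rewrite mulr0n -(pchar_Zp n1) fout // vn leqnn.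
  case: ifP => h; first by rewrite fin //; lia.
  by rewrite fout //; lia.
exists (e + 1)%R, v; split; first by rewrite v1.
have fy : f y = f (o + 1)%R.
  by have := fE y; case: ifP => // _ h; rewrite h eqxx in fxy.
by move=> i; rewrite fE fy.
Qed.

(** The only changes are at the two ends of the arc. *)
Lemma cuts_arc (n : nat) (T : eqType) (f : 'Z_n -> T) (l : 'Z_n) (v : nat)
    (a b : T) : 1 < n ->
  (forall i, f i = if (i - l)%R < v then b else a) -> ncuts f <= 2.
Proof.
move=> n1 fE.
have sub : cuts f \subset [set (l - 1)%R; (l + v.-1%:R)%R]%SET.
  apply/fintype.subsetP => i; rewrite !inE !fE; apply: contraNT.
  rewrite negb_or => /andP[i1 i2].
  have -> : (i + 1 - l = (i - l) + 1)%R by rewrite addrAC.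
  rewrite (val_addZp (i - l)%R 1%R n1) val_oneZp //.
  have lt := Zp_lt (i - l)%R n1.
  have j1 : nat_of_ord (i - l)%R != n.-1.
    apply: contra i1 => /eqP h; rewrite -(subrK l i) addrC; apply/eqP; congr (_ + _)%R.
    apply: ord_inj; rewrite h -[(-1)%R]add0r val_subZp // val_oneZp //=; lia.
  have j2 : nat_of_ord (i - l)%R != v.-1.
    by apply: contra i2 => /eqP h; rewrite -h natr_Zp addrC subrK.
  rewrite [if _ + 1 < n then _ else _]ifT; last lia.
  have -> : ((i - l)%R + 1 < v) = ((i - l)%R < v) by lia.
  by rewrite eqxx.
by apply: leq_trans (subset_leq_card sub) _; rewrite cards2; case: eqP.
Qed.

Lemma cuts_const (n : nat) (T : eqType) (f : 'Z_n -> T) :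
  (forall i j, f i = f j) -> ncuts f = 0.
Proof. by move=> h; apply: eq_card0 => i; rewrite !inE (h i (i + 1)%R) eqxx. Qed.

Lemma eq_cuts (n : nat) (T : eqType) (f g : 'Z_n -> T) :
  f =1 g -> cuts f = cuts g.
Proof. by move=> h; apply/setP => i; rewrite !inE !h. Qed.

(** Reading the cycle backwards from [l] is reading it forwards from [l + 1]
    and reversing the order, so that descending thresholds are arcs too. *)
Lemma val_revZp (n : nat) (l i : 'Z_n) : 1 < n ->
  (l - i)%R = n.-1 - (i - (l + 1))%R :> nat.
Proof.
move=> n1; have -> : (l - i = -1 - (i - (l + 1)))%R.
  by rewrite opprB addrA [(l + 1)%R]addrC addKr.
have := Zp_lt (i - (l + 1))%R n1.
have m1 : (-1 : 'Z_n)%R = n.-1 :> nat.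
  by rewrite -[(-1)%R]add0r val_subZp // val_oneZp //=; lia.
by rewrite (val_subZp _ (i - (l + 1))%R n1) m1; case: ifP; lia.
Qed.

(** * The energy as a sum over lines *)

Definition hslice (K L q : nat) (s : config K L q) (y : 'Z_L) : 'Z_K -> 'I_q :=
  fun x => s (x, y).

Definition vslice (K L q : nat) (s : config K L q) (x : 'Z_K) : 'Z_L -> 'I_q :=
  fun y => s (x, y).

Definition succ_site (K L : nat) (d : bool) (x : site K L) : site K L :=
  if d then (x.1 + 1, x.2)%R else (x.1, x.2 + 1)%R.

Definition bond (K L : nat) (p : site K L * bool) : {set site K L} :=
  [set p.1; succ_site p.2 p.1]%SET.

Lemma Zp_succ_neq (n : nat) (x : 'Z_n) : 1 < n -> (x + 1)%R != x.
Proof.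
move=> n1; rewrite -subr_eq0 addrAC subrr add0r; apply/eqP.
by move/(congr1 (@nat_of_ord _)); rewrite val_oneZp.
Qed.

Lemma Zp_succ2_neq (n : nat) (x : 'Z_n) : 2 < n -> (x + 1 + 1)%R != x.
Proof.
move=> n2; rewrite -addrA -subr_eq0 addrAC subrr add0r; apply/eqP.
move/(congr1 (@nat_of_ord _)); rewrite -(natrD _ 1 1) val_natZp //; lia.
Qed.

(** On a cycle of length 2 the bonds that start at the two sites would
    coincide; this is where the lengths have to exceed 2. *)
Lemma bond_inj (K L : nat) : 2 < K -> 2 < L -> injective (@bond K L).
Proof.
move=> K2 L2 [[x y] d] [[x' y'] d'] /setP E.
have K1 := ltnW K2; have L1 := ltnW L2.
have := E (x, y); have := E (succ_site d (x, y)).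
have := E (x', y'); have := E (succ_site d' (x', y')).
rewrite /bond !inE !eqxx !orbT /= /succ_site.
have nx z : (z + 1 == z :> 'Z_K)%R = false by apply/negbTE/Zp_succ_neq.
have ny z : (z + 1 == z :> 'Z_L)%R = false by apply/negbTE/Zp_succ_neq.
have nx' z : (z == z + 1 :> 'Z_K)%R = false by rewrite eq_sym.
have ny' z : (z == z + 1 :> 'Z_L)%R = false by rewrite eq_sym.
have nnx z : (z + 1 + 1 == z :> 'Z_K)%R = false by apply/negbTE/Zp_succ2_neq.
have nny z : (z + 1 + 1 == z :> 'Z_L)%R = false by apply/negbTE/Zp_succ2_neq.
have nnx' z : (z == z + 1 + 1 :> 'Z_K)%R = false by rewrite eq_sym.
have nny' z : (z == z + 1 + 1 :> 'Z_L)%R = false by rewrite eq_sym.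
have simp := (nx, ny, nx', ny', nnx, nny, nnx', nny').
clear E; case: d; case: d' => /=; rewrite /eq_op /= => h1 h2 h3 h4;
  (case: (x =P x') h1 h2 h3 h4 => [->|_]; case: (y =P y') => [->|_] //=;
   rewrite ?eqxx ?simp ?andbT ?andbF ?orbF //=).
all: by move=> _ /orP[/eqP->|/eqP->] _ //; rewrite simp.
Qed.

Lemma edgesE (K L : nat) : edges K L = [set bond p | p : site K L * bool]%SET.
Proof.
apply/setP => e; rewrite inE; apply/idP/imsetP.
  case/existsP => -[x1 x2] /existsP[[y1 y2]] /andP[+ /eqP->].
  rewrite /adj /= => /orP[]/andP[/eqP-> /orP[]/eqP->].
  - by exists ((y1, x2), false).
  - by exists ((y1, y2), false) => //; rewrite finset.setUC.
  - by exists ((x1, y2), true).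
  - by exists ((y1, y2), true) => //; rewrite finset.setUC.
move=> [[[x y] d] _ ->]; apply/existsP; exists (x, y); apply/existsP.
exists (succ_site d (x, y)); rewrite eqxx andbT /adj.
by case: d; rewrite /= !eqxx ?orbT.
Qed.

Lemma bond_cut (K L q : nat) (s : config K L q) (p : site K L * bool) :
  [exists x in bond p, exists y in bond p, s x != s y] =
  (s p.1 != s (succ_site p.2 p.1)).
Proof.
apply/existsP/idP => [[x /andP[xp /existsP[y /andP[yp]]]]|h].
  move: xp yp; rewrite !inE => /orP[]/eqP-> /orP[]/eqP->; rewrite ?eqxx //.
  by rewrite eq_sym.
exists p.1; rewrite !inE eqxx; apply/existsP; exists (succ_site p.2 p.1).
by rewrite !inE eqxx orbT.
Qed.

Lemma sum_cuts (n : nat) (T : eqType) (f : 'Z_n -> T) :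
  \sum_i (f i != f (i + 1)%R) = ncuts f.
Proof.
rewrite /ncuts -sum1_card [in RHS]big_mkcond; apply: eq_bigr => i _.
by rewrite inE; case: (_ != _).
Qed.

(** The undirected edges are the bonds from each site to its successor in
    either direction, counted once. *)
Lemma energy_lines (K L q : nat) (s : config K L q) : 2 < K -> 2 < L ->
  H s = \sum_(x : 'Z_K) ncuts (vslice s x) + \sum_(y : 'Z_L) ncuts (hslice s y).
Proof.
move=> K2 L2; rewrite /H edgesE big_imset /=; last first.
  by move=> p p' _ _; apply: bond_inj.
under eq_bigr do rewrite bond_cut.
rewrite -(pair_bigA _ (fun x d => nat_of_bool (s x != s (succ_site d x)))) /=.
under eq_bigr do rewrite big_bool.
rewrite big_split /= addnC; congr (_ + _).
  under [RHS]eq_bigr do rewrite -sum_cuts.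
  by rewrite pair_bigA /=; apply: eq_bigr => -[x y] _.
under [RHS]eq_bigr do rewrite -sum_cuts.
by rewrite exchange_big pair_bigA /=; apply: eq_bigr => -[x y] _.
Qed.

(** * Configurations with two full rows of different colours *)

(** The arcs that define strips and bars, as thresholds on the distance. *)
Lemma arc_val (n : nat) (y l : 'Z_n) (v : nat) : 1 < n -> v <= n ->
  [exists m : 'I_v, y == (l + m%:R)%R] = ((y - l)%R < v).
Proof.
move=> n1 vn; apply/existsP/idP => [[m /eqP->]|h].
  by rewrite addrC addKr val_natZp //; apply: leq_trans vn.
by exists (Ordinal h); rewrite -{1}(subrK l y) addrC -[X in (_ + X == _)%R]natr_Zp.
Qed.

Lemma sum_tight (I : finType) (F : I -> nat) (c : nat) :
  (forall i, c <= F i) -> \sum_i F i <= c * #|I| -> forall i, F i <= c.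
Proof.
move=> cF; rewrite mulnC -sum_nat_const => le i; move: le.
rewrite (bigD1 i) //= [X in _ <= X](bigD1 i) //=.
have : \sum_(j | j != i) c <= \sum_(j | j != i) F j by apply: leq_sum.
by lia.
Qed.

Lemma card_Zp_type (n : nat) : 1 < n -> #|'Z_n| = n.
Proof. by move=> n1; rewrite card_ord Zp_cast. Qed.

(** If two rows differ in every column, each of the K columns has at least
    two changes, which leaves two of the 2K + 2 for the rows. *)
Lemma rows_sum_le2 (K L q : nat) (s : config K L q) (y1 y2 : 'Z_L) :
  2 < K -> 2 < L -> H s <= Gam K -> (forall x, s (x, y1) != s (x, y2)) ->
  \sum_(y : 'Z_L) ncuts (hslice s y) <= 2.
Proof.
move=> K2 L2; rewrite energy_lines // /Gam => Hs ne.
have : \sum_(x : 'Z_K) 2 <= \sum_(x : 'Z_K) ncuts (vslice s x).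
  by apply: leq_sum => x _; exact: (@cuts_ge2 _ _ (vslice s x) y1 y2 (ne x)).
rewrite sum_nat_const card_Zp_type ?(ltnW K2) //; lia.
Qed.

(** A broken row uses up the two changes left by the columns, so no column
    can have more than its two. *)
Lemma cols_le2 (K L q : nat) (s : config K L q) (y1 y2 : 'Z_L) :
  2 < K -> 2 < L -> H s <= Gam K -> (forall x, s (x, y1) != s (x, y2)) ->
  forall j, 1 < ncuts (hslice s j) -> forall x, ncuts (vslice s x) <= 2.
Proof.
move=> K2 L2; rewrite energy_lines // /Gam => Hs ne j cj x.
apply: (@sum_tight _ (fun x => ncuts (vslice s x))) => [z|].
  exact: (@cuts_ge2 _ _ (vslice s _) y1 y2 (ne _)).
move: Hs; rewrite [X in _ + X](bigD1 j) //= card_Zp_type ?(ltnW K2) //; lia.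
Qed.

Lemma other_rows_const (K L q : nat) (s : config K L q) (y1 y2 : 'Z_L) :
  2 < K -> 2 < L -> H s <= Gam K -> (forall x, s (x, y1) != s (x, y2)) ->
  forall j, 1 < ncuts (hslice s j) -> forall y, y != j ->
  forall x x', s (x, y) = s (x', y).
Proof.
move=> K2 L2 Hs ne j cj y yj.
have := rows_sum_le2 K2 L2 Hs ne.
rewrite (bigD1 j) //= (bigD1 y) //= => h.
by apply: (@cuts_le1_const _ _ (hslice s y)); lia.
Qed.

(** If all rows are monochromatic, the columns are copies of one another and
    have exactly two changes: a strip.  Otherwise exactly one row [j] is
    broken, every column consists of an arc of [b] and an arc of [a], and so
    does row [j].  The other rows form a strip; a column in which [j] has the
    colour [b] would have too many changes if [j] were not next to the
    strip. *)
Lemma full_rows_strip (K L q : nat) (s : config K L q) (a b : 'I_q) (y1 y2 : 'Z_L) :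
  2 < K -> 2 < L -> a != b -> H s <= Gam K ->
  (forall x, s (x, y1) = a) -> (forall x, s (x, y2) = b) ->
  (exists v, 1 <= v <= L - 1 /\ Rtilde K L a b v s) \/
  (exists v, 1 <= v <= L - 2 /\ Qtilde K L a b v s).
Proof.
move=> K2 L2 ab Hs sa sb.
have K1 := ltnW K2; have L1 := ltnW L2.
have ne x : s (x, y1) != s (x, y2) by rewrite sa sb.
have ne' x : s (x, y2) != s (x, y1) by rewrite sa sb eq_sym.
have [/forallP rc|] := boolP [forall y, ncuts (hslice s y) <= 1].
  left; have rowc y x x' : s (x, y) = s (x', y) by apply: (cuts_le1_const (rc y)).
  have colE x : ncuts (vslice s x) = ncuts (vslice s 0%R).
    by congr #|pred_of_set _|; apply: eq_cuts => y; apply: rowc.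
  have c2 : ncuts (vslice s 0%R) <= 2.
    move: Hs; rewrite energy_lines // /Gam.
    rewrite (eq_bigr (fun=> ncuts (vslice s 0%R))) // sum_nat_const card_Zp_type //.
    by nia.
  have [l [v [vb sE]]] := cuts2_arc L1 (ne' 0%R) c2.
  exists v; split; first lia.
  exists l; apply/ffunP => -[x y]; rewrite ffunE /= arc_val //; last lia.
  by rewrite (rowc y x 0%R); have := sE y; rewrite /vslice sa sb.
rewrite negb_forall => /existsP[j]; rewrite -ltnNge => cj; right.
have rowc := other_rows_const K2 L2 Hs ne cj.
have c2 := cols_le2 K2 L2 Hs ne cj.
have valab x y : s (x, y) = a \/ s (x, y) = b.
  have [l [v [_ sE]]] := cuts2_arc L1 (ne' x) (c2 x).
  by have := sE y; rewrite /vslice sa sb; case: ifP => _ ->; [right|left].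
have [xa [xb [ea eb]]] : exists xa xb, s (xa, j) = a /\ s (xb, j) = b.
  have /card_gt0P[x] : 0 < ncuts (hslice s j) by lia.
  rewrite inE /hslice => h; move: (valab x j) (valab (x + 1)%R j) h.
  case=> e1 [] e2; rewrite e1 e2 ?eqxx // => _; first by exists x, (x + 1)%R.
  by exists (x + 1)%R, x.
have rj2 : ncuts (hslice s j) <= 2.
  by have := rows_sum_le2 K2 L2 Hs ne; rewrite (bigD1 j) //=; lia.
have nej : hslice s j xb != hslice s j xa by rewrite /hslice ea eb eq_sym.
have [k [h [hb rE]]] := cuts2_arc K1 nej rj2.
have [l [v [vb cE]]] := cuts2_arc L1 (ne' xa) (c2 xa).
rewrite /hslice /vslice ea eb sa sb in rE cE.
have jv : v <= (j - l)%R.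
  by rewrite leqNgt; apply/negP => jl; have := cE j; rewrite jl ea => /eqP/idPn.
have jl := Zp_lt (j - l)%R L1.
have sE x y : y != j -> s (x, y) = if (y - l)%R < v then b else a.
  by move=> yj; rewrite (rowc y yj x xa) cE.
(* Otherwise column [xb] changes below [j], above [j] and below [l]. *)
have ends : nat_of_ord (j - l)%R = v \/ nat_of_ord (j - l)%R = L.-1.
  have [->|j1] := eqVneq (nat_of_ord (j - l)%R) v; first by left.
  have [->|j2] := eqVneq (nat_of_ord (j - l)%R) L.-1; first by right.
  have := c2 xb.
  have vm : (j - 1 - l)%R = (j - l)%R - 1 :> nat.
    by rewrite addrAC (val_subZp (j - l)%R 1%R L1) val_oneZp // ifT //; lia.
  have vp : (j + 1 - l)%R = (j - l)%R + 1 :> nat.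
    by rewrite addrAC (val_addZp (j - l)%R 1%R L1) val_oneZp // ifT //; lia.
  have lm : (l - 1 - l)%R = L.-1 :> nat.
    by rewrite addrAC subrr (val_subZp 0%R 1%R L1) val_oneZp //= ; lia.
  have d1 : (j - 1)%R != j.
    by apply: contra_neq (Zp_succ_neq (j - 1)%R L1); rewrite subrK => ->.
  have d2 : (l - 1)%R != j by apply/eqP => e; move: j2; rewrite -e lm eqxx.
  have d3 : (l - 1)%R != (j - 1)%R.
    apply/eqP => e; have lj : l = j by rewrite -(subrK 1%R l) e subrK.
    by move: j1 jv; rewrite lj subrr /=; lia.
  have d4 : l != j.
    by apply: contra_neq d3 => ->.
  have d5 : (j + 1)%R != j by apply: Zp_succ_neq.
  have sub : [set (j - 1)%R; j; (l - 1)%R]%SET \subset cuts (vslice s xb).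
    apply/fintype.subsetP => z; rewrite !inE /vslice.
    case/orP => [/orP[]|] /eqP->.
    - by rewrite subrK eb sE // vm ifF //; lia.
    - by rewrite eb sE // vp ifF 1?eq_sym //; lia.
    - by rewrite subrK !sE // lm subrr ifF ?ifT //=; lia.
  have := subset_leq_card sub.
  rewrite -finset.setUA cardsU1 cards2 !inE negb_or d1 [(_ == l - 1)%R]eq_sym d3.
  by rewrite [(_ == l - 1)%R]eq_sym d2 /ncuts => h3 h2; have := leq_trans h3 h2.
have vL : v <= L - 2.
  have y1j : y1 != j.
    by apply: contraTneq ab => e; rewrite -(sa xb) e eb eqxx.
  have y1v : v <= (y1 - l)%R.
    rewrite leqNgt; apply/negP => h1; have := sE xa _ y1j.
    by rewrite h1 sa => /eqP/idPn.
  have y1l := Zp_lt (y1 - l)%R L1.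
  have : nat_of_ord (y1 - l)%R != nat_of_ord (j - l)%R.
    by apply: contra_neq y1j => /ord_inj/addIr.
  by lia.
exists v; split; first lia.
exists l, k, h; split; first lia.
case: ends => e; [left|right]; apply/ffunP => -[x y];
  rewrite ffunE /= !arc_val //; try lia.
  have -> : (y == l + v%:R)%R = (y == j).
    by rewrite -e natr_Zp [(l + _)%R]addrC subrK.
  have [->|yj] := eqVneq y j; last by rewrite andbF orbF sE.
  by rewrite andbT rE [(j - l)%R < v]ltnNge jv.
have -> : (y == l - 1)%R = (y == j).
  congr (_ == _); rewrite -(subrK l j) addrC; congr (_ + _)%R; apply: ord_inj.
  by rewrite e -[(-1)%R]add0r (val_subZp _ _ L1) val_oneZp //= ; lia.
have [->|yj] := eqVneq y j; last by rewrite andbF orbF sE.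
by rewrite andbT rE [(j - l)%R < v]ltnNge jv.
Qed.

(** * Filling the torus site by site *)

Definition cnt (K L q : nat) (c : 'I_q) (s : config K L q) : nat :=
  #|[set x | s x == c]%SET|.

Lemma card_site (K L : nat) : 1 < K -> 1 < L -> #|site K L| = K * L.
Proof. by move=> K1 L1; rewrite card_prod !card_Zp_type. Qed.

Lemma cnt_le (K L q : nat) (a b : 'I_q) (s : config K L q) :
  1 < K -> 1 < L -> a != b -> cnt a s + cnt b s <= K * L.
Proof.
move=> K1 L1 ab; rewrite -card_site // /cnt -cardsUI.
rewrite [X in _ + #|pred_of_set X|](_ : _ = finset.set0) ?cards0 ?addn0 ?max_card //.
apply/setP => x; rewrite !inE; apply/negbTE; apply: contra ab.
by case/andP => /eqP-> .
Qed.

Lemma cnt_two (K L q : nat) (a b : 'I_q) (s : config K L q) :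
  1 < K -> 1 < L -> a != b -> (forall x, s x = a \/ s x = b) ->
  cnt a s + cnt b s = K * L.
Proof.
move=> K1 L1 ab sab; rewrite -card_site // -(cardsC [set x | s x == a]%SET).
congr (_ + #|pred_of_set _|); apply/setP => x; rewrite !inE.
by case: (sab x) => ->; rewrite eqxx ?(negbTE ab) // eq_sym ab.
Qed.

Lemma cnt_other (K L q : nat) (a b c : 'I_q) (s : config K L q) :
  (forall x, s x = a \/ s x = b) -> c != a -> c != b -> cnt c s = 0.
Proof.
move=> sab ca cb; apply: eq_card0 => x; rewrite !inE.
by case: (sab x) => ->; rewrite eq_sym; apply/negbTE.
Qed.

(** Position of a site when the torus is filled row by row, upwards or
    downwards from row [l], each row from column [k] on.  Both directions are
    needed because a bar can lie on either side of a strip. *)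
Definition fill_rank (K L : nat) (up : bool) (l : 'Z_L) (k : 'Z_K) (x : site K L) : nat :=
  (if up then x.2 - l else l - x.2)%R * K + (x.1 - k)%R.

Definition tower (K L q : nat) (a b : 'I_q) (up : bool) (l : 'Z_L) (k : 'Z_K)
    (n : nat) : config K L q :=
  [ffun x => if fill_rank up l k x < n then b else a].

Lemma tower_two (K L q : nat) (a b : 'I_q) (up : bool) (l : 'Z_L) (k : 'Z_K)
    (n : nat) (x : site K L) :
  tower a b up l k n x = a \/ tower a b up l k n x = b.
Proof. by rewrite ffunE; case: ifP; [right|left]. Qed.

Lemma fill_rank_surj (K L : nat) (up : bool) (l : 'Z_L) (k : 'Z_K) (n : nat) :
  1 < K -> 1 < L -> n < K * L -> exists x, fill_rank up l k x = n.
Proof.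
move=> K1 L1 nKL.
have q1 : n %/ K < L by rewrite ltn_divLR; lia.
have r1 : n %% K < K by rewrite ltn_mod; lia.
pose m := (n %/ K)%:R%R : 'Z_L.
exists ((k + (n %% K)%:R)%R, (if up then l + m else l - m)%R).
set x := (_, _); have e1 : (x.1 - k)%R = (n %% K)%:R%R by rewrite addrC addKr.
have e2 : (if up then x.2 - l else l - x.2)%R = m.
  by rewrite {e1}/x /=; case: (up); [rewrite addrC addKr | rewrite opprB addrC subrK].
by rewrite /fill_rank e1 e2 !val_natZp // -divn_eq.
Qed.

Lemma fill_rank_inj (K L : nat) (up : bool) (l : 'Z_L) (k : 'Z_K) :
  1 < K -> 1 < L -> injective (@fill_rank K L up l k).
Proof.
move=> K1 L1 x x' e; rewrite [x]surjective_pairing [x']surjective_pairing.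
have lx := Zp_lt (x.1 - k)%R K1; have lx' := Zp_lt (x'.1 - k)%R K1.
have K0 := ltnW K1.
have ex : nat_of_ord (x.1 - k)%R = nat_of_ord (x'.1 - k)%R.
  have := congr1 (modn^~ K) e; rewrite /fill_rank.
  by rewrite !modnMDl !modn_small.
have ey : (if up then x.2 - l else l - x.2)%R = (if up then x'.2 - l else l - x'.2)%R.
  apply: ord_inj; have := congr1 (divn^~ K) e; rewrite /fill_rank.
  by rewrite !divnMDl // !divn_small // !addn0.
move/ord_inj/addIr: ex => ->; congr pair.
by case: up ey {e} => [/addIr|/addrI/oppr_inj].
Qed.

Lemma tower0 (K L q : nat) (a b : 'I_q) (up : bool) (l : 'Z_L) (k : 'Z_K) :
  tower a b up l k 0 = mono K L a.
Proof. by apply/ffunP => x; rewrite !ffunE. Qed.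

Lemma step_tower (K L q : nat) (a b : 'I_q) (up : bool) (l : 'Z_L) (k : 'Z_K)
    (n : nat) : 1 < K -> 1 < L -> a != b -> n < K * L ->
  step (tower a b up l k n) (tower a b up l k n.+1).
Proof.
move=> K1 L1 ab nKL; have [x0 e0] := fill_rank_surj up l k K1 L1 nKL.
rewrite /step (_ : [set x | _]%SET = [set x0]%SET) ?cards1 //.
apply/setP => x; rewrite !inE !ffunE.
have -> : (x == x0) = (fill_rank up l k x == n).
  by rewrite -e0 (inj_eq (@fill_rank_inj _ _ _ _ _ K1 L1)).
by rewrite ltnS; case: ltngtP => _; rewrite ?eqxx ?ab.
Qed.

Lemma cnt_tower (K L q : nat) (a b : 'I_q) (up : bool) (l : 'Z_L) (k : 'Z_K)
    (n : nat) : 1 < K -> 1 < L -> a != b -> n <= K * L ->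
  cnt b (tower a b up l k n) = n.
Proof.
move=> K1 L1 ab; elim: n => [|n IH] nKL.
  by apply: eq_card0 => x; rewrite !inE ffunE (negbTE ab).
have [x0 e0] := fill_rank_surj up l k K1 L1 nKL.
rewrite -[in RHS](IH (ltnW nKL)) /cnt (cardsD1 x0) inE ffunE e0 ltnSn eqxx add1n.
congr (_.+1); apply: eq_card => x; rewrite !inE !ffunE.
have -> : (x == x0) = (fill_rank up l k x == n).
  by rewrite -e0 (inj_eq (@fill_rank_inj _ _ _ _ _ K1 L1)).
by rewrite ltnS; case: ltngtP; rewrite ?(negbTE ab).
Qed.

(** In a fixed column, the condition on the filling position is a threshold
    on the distance from the row where the filling starts. *)
Lemma tower_column (K L q : nat) (a b : 'I_q) (up : bool) (l : 'Z_L)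
  (k : 'Z_K) (n : nat) (x : 'Z_K) : 1 < K -> 1 < L ->
  ncuts (vslice (tower a b up l k n) x) <= 2.
Proof.
move=> K1 L1; pose p := nat_of_ord (x - k)%R.
have pK : p < K by apply: Zp_lt.
(* [c] is the ceiling of (n - p) / K, truncated at 0. *)
pose c := (n + (K.-1 - p)) %/ K.
have cE t : (t * K + p < n) = (t < c).
  by rewrite /c -[t < _]/(t.+1 <= _) leq_divRL; lia.
case: up.
  by apply: (@cuts_arc _ _ _ l c a b L1) => y; rewrite /vslice ffunE /fill_rank cE.
apply: (@cuts_arc _ _ _ (l + 1)%R (L - c) b a L1) => y.
rewrite /vslice ffunE /fill_rank cE val_revZp // -[(x, y).2]/y.
have := Zp_lt (y - (l + 1))%R L1.
by move: (nat_of_ord (y - _)%R) => t; case: ifP => h1; case: ifP => h2 // ?; exfalso; lia.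
Qed.

(** Only the row under construction is broken. *)
Lemma tower_rows (K L q : nat) (a b : 'I_q) (up : bool) (l : 'Z_L)
  (k : 'Z_K) (n : nat) : 1 < K -> 1 < L ->
  \sum_y ncuts (hslice (tower a b up l k n) y) <= 2.
Proof.
move=> K1 L1; have K0 := ltnW K1.
pose d y := nat_of_ord (if up then y - l else l - y)%R.
have dinj : injective d.
  by move=> y y'; rewrite /d => /ord_inj; case: (up) => [/addIr|/addrI/oppr_inj].
have flat y : d y != n %/ K -> ncuts (hslice (tower a b up l k n) y) = 0.
  move=> dy; apply: cuts_const => i j; rewrite /hslice !ffunE /fill_rank.
  change ((if d y * K + (i - k)%R < n then b else a) =
          (if d y * K + (j - k)%R < n then b else a)).
  have li := Zp_lt (i - k)%R K1; have lj := Zp_lt (j - k)%R K1.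
  have := divn_eq n K; have := ltn_pmod n K0; move: dy.
  move: (n %/ K) (n %% K) (d y) => A B D; case: (ltngtP D A) => // h _ lB ->.
    have : D.+1 * K <= A * K by rewrite leq_mul2r h orbT.
    by rewrite mulSn => e; rewrite !ifT //; lia.
  have : A.+1 * K <= D * K by rewrite leq_mul2r h orbT.
  by rewrite mulSn => e; rewrite !ifF //; lia.
have [y0 e0|none] := pickP (fun y => d y == n %/ K); last first.
  by rewrite big1 // => y _; apply: flat; rewrite none.
rewrite (bigD1 y0) //= big1 ?addn0 => [|y yy0]; last first.
  by apply: flat; rewrite -(eqP e0) (inj_eq dinj).
apply: (@cuts_arc _ _ _ k (n - d y0 * K) a b K1) => x.
rewrite /hslice ffunE /fill_rank.
change ((if d y0 * K + (x - k)%R < n then b else a) =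
        (if (x - k)%R < n - d y0 * K then b else a)).
by congr (if _ then _ else _); lia.
Qed.

Lemma energy_tower (K L q : nat) (a b : 'I_q) (up : bool) (l : 'Z_L)
  (k : 'Z_K) (n : nat) : 2 < K -> 2 < L ->
  H (tower a b up l k n) <= Gam K.
Proof.
move=> K2 L2; have K1 := ltnW K2; have L1 := ltnW L2.
rewrite energy_lines // /Gam leq_add ?tower_rows //.
rewrite mulnC -[X in X * _](card_Zp_type K1) -sum_nat_const.
by apply: leq_sum => x _; apply: tower_column.
Qed.

Lemma row_rank (K h p t v : nat) : p < K -> h <= K ->
  (t * K + p < v * K + h) = (t < v) || (p < h) && (t == v).
Proof.
move=> pK hK; case: (ltngtP t v) => /= [tv|vt|->]; rewrite ?andbF ?andbT.
- have : t.+1 * K <= v * K by rewrite leq_mul2r tv orbT.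
  by rewrite mulSn; lia.
- have : v.+1 * K <= t * K by rewrite leq_mul2r vt orbT.
  by rewrite mulSn; lia.
- by rewrite ltn_add2l.
Qed.

Lemma strip_plusE (K L q : nat) (a b : 'I_q) (l : 'Z_L) (v : nat) (k : 'Z_K)
  (h : nat) : 1 < K -> 1 < L -> v < L -> h <= K ->
  strip_plus a b l v k h = tower a b true l k (v * K + h).
Proof.
move=> K1 L1 vL hK; apply/ffunP => -[x y]; rewrite !ffunE /fill_rank.
rewrite -[(x, y).1]/x -[(x, y).2]/y.
rewrite !arc_val //; last exact: ltnW.
rewrite row_rank ?Zp_lt //.
suff -> : (y == l + v%:R)%R = (nat_of_ord (y - l)%R == v) by [].
rewrite -{1}(subrK l y) [(_ + l)%R]addrC (inj_eq (addrI _)).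
by apply/eqP/eqP => [->|e]; [rewrite val_natZp | rewrite -e natr_Zp].
Qed.

(** A bar below the strip is the row that comes next when the strip is filled
    from its top row, [l + v - 1], downwards. *)
Lemma strip_minusE (K L q : nat) (a b : 'I_q) (l : 'Z_L) (v : nat) (k : 'Z_K)
  (h : nat) : 1 < K -> 1 < L -> v < L -> h <= K ->
  strip_minus a b l v k h =
  tower a b false (l + v%:R - 1)%R k (v * K + h).
Proof.
move=> K1 L1 vL hK; apply/ffunP => -[x y]; rewrite !ffunE /fill_rank.
rewrite -[(x, y).1]/x -[(x, y).2]/y.
rewrite !arc_val //; last exact: ltnW.
rewrite row_rank ?Zp_lt //.
have lt := Zp_lt (y - l)%R L1.
have E : (l + v%:R - 1 - y)%R =
    (if (y - l)%R < v then v.-1 - (y - l)%R else v + L.-1 - (y - l)%R) :> nat.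
  rewrite val_revZp // subrK opprD addrA (val_subZp (y - l)%R v%:R%R L1) val_natZp //.
  by case: ifP; case: ifP; lia.
have -> : (y == l - 1)%R = (nat_of_ord (y - l)%R == L.-1).
  rewrite -{1}(subrK l y) [(_ + l)%R]addrC (inj_eq (addrI _)).
  have m1 : (-1 : 'Z_L)%R = L.-1 :> nat.
    by rewrite -[(-1)%R]add0r val_subZp // val_oneZp //=; lia.
  by apply/eqP/eqP => [->|e] //; apply: ord_inj; rewrite e.
rewrite E; congr (if _ then _ else _).
move: (nat_of_ord (y - l)%R) lt => t lt.
case: ltnP => h1; first by rewrite [_ < v](_ : _ = true) //; lia.
rewrite [_ < v](_ : _ = false); last lia.
by congr (_ && _); lia.
Qed.

Lemma stripE (K L q : nat) (a b : 'I_q) (l : 'Z_L) (v : nat) :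
  1 < K -> 1 < L -> v <= L ->
  strip K a b l v = tower a b true l 0%R (v * K).
Proof.
move=> K1 L1 vL; apply/ffunP => -[x y]; rewrite !ffunE /fill_rank.
rewrite -[(x, y).1]/x -[(x, y).2]/y.
by rewrite arc_val // -[v * K]addn0 row_rank ?Zp_lt //= orbF.
Qed.

(** * Transposition *)

Lemma transp_app (K q : nat) (s : config K K q) (x y : 'Z_K) :
  transp s (x, y) = s (y, x).
Proof. by rewrite ffunE !valZpK. Qed.

Lemma transpK (K q : nat) : involutive (@transp K K q).
Proof. by move=> s; apply/ffunP => -[x y]; rewrite !transp_app. Qed.

Lemma energy_transp (K q : nat) (s : config K K q) : 2 < K ->
  H (transp s) = H s.
Proof.
move=> K2; rewrite !energy_lines // addnC; congr (_ + _);
  apply: eq_bigr => i _; congr #|pred_of_set _|; apply: eq_cuts => j;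
  exact: transp_app.
Qed.

Definition swap (K : nat) (x : site K K) : site K K := (x.2, x.1).

Lemma swapK (K : nat) : involutive (@swap K).
Proof. by case. Qed.

Lemma transp_swap (K q : nat) (s : config K K q) (x : site K K) :
  transp s x = s (swap x).
Proof. by case: x => x y; rewrite transp_app. Qed.

Lemma card_swap (K : nat) (A B : {set site K K}) :
  (forall x, (x \in A) = (swap x \in B)) -> #|A| = #|B|.
Proof.
move=> h; rewrite -(card_imset (mem B) (inv_inj (@swapK K))).
apply: eq_card => x; rewrite h; apply/idP/imsetP => [xB|[y yB ->]].
  by exists (swap x); rewrite ?swapK.
by rewrite swapK.
Qed.

Lemma cnt_transp (K q : nat) (c : 'I_q) (s : config K K q) :
  cnt c (transp s) = cnt c s.
Proof. by apply: card_swap => x; rewrite !inE transp_swap. Qed.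

Lemma step_transp (K q : nat) (s t : config K K q) :
  step (transp s) (transp t) = step s t.
Proof.
by rewrite /step; congr (_ == 1); apply: card_swap => x; rewrite !inE !transp_swap.
Qed.

Lemma transp_mono (K q : nat) (a : 'I_q) : transp (mono K K a) = mono K K a.
Proof. by apply/ffunP => x; rewrite !ffunE. Qed.

(** The transpose is an involution when K = L, so membership up to
    transposition can be tested on either representative. *)
Lemma RsetE (K L q : nat) (a b : 'I_q) (v : nat) (s : config K L q) :
  Rset K L a b v s <-> Rtilde K L a b v s \/ K = L /\ Rtilde K L a b v (transp s).
Proof.
rewrite /Rset; case: eqP => [KL|nKL]; last by split=> [|[|[]]] //; left.
subst L; split=> [[|[u hu <-]]|[|[_ h]]]; [by left| |by left|].
  by right; rewrite transpK.
by right; exists (transp s); rewrite ?transpK.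
Qed.

Lemma QsetE (K L q : nat) (a b : 'I_q) (v : nat) (s : config K L q) :
  Qset K L a b v s <-> Qtilde K L a b v s \/ K = L /\ Qtilde K L a b v (transp s).
Proof.
rewrite /Qset; case: eqP => [KL|nKL]; last by split=> [|[|[]]] //; left.
subst L; split=> [[|[u hu <-]]|[|[_ h]]]; [by left| |by left|].
  by right; rewrite transpK.
by right; exists (transp s); rewrite ?transpK.
Qed.

Lemma Rtilde_tower (K L q : nat) (a b : 'I_q) (v : nat) (s : config K L q) :
  1 < K -> 1 < L -> v <= L -> Rtilde K L a b v s ->
  exists up l k, s = tower a b up l k (v * K).
Proof. by move=> K1 L1 vL [l ->]; exists true, l, 0%R; rewrite stripE. Qed.

Lemma Qtilde_tower (K L q : nat) (a b : 'I_q) (v : nat) (s : config K L q) :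
  1 < K -> 1 < L -> v < L -> Qtilde K L a b v s ->
  exists up l k h, 1 <= h <= K - 1 /\ s = tower a b up l k (v * K + h).
Proof.
move=> K1 L1 vL [l [k [h [hK]]]].
have hK' : h <= K by lia.
case=> ->; first by exists true, l, k, h; rewrite strip_plusE.
by exists false, (l + v%:R - 1)%R, k, h; rewrite strip_minusE.
Qed.

(** * Counting spins *)

(** The common form of all canonical configurations: [n] sites of colour [b]
    filled in order, along rows or, on a square torus, along columns. *)
Definition oriented_tower (K L q : nat) (a b : 'I_q) (n : nat)
    (s : config K L q) : Prop :=
  exists up l k, s = tower a b up l k n \/
                 K = L /\ transp s = tower a b up l k n.

Lemma Rset_tower (K L q : nat) (a b : 'I_q) (v : nat) (s : config K L q) :
  1 < K -> 1 < L -> v <= L -> Rset K L a b v s -> oriented_tower a b (v * K) s.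
Proof.
move=> K1 L1 vL /RsetE[|[KL]] /(Rtilde_tower K1 L1 vL)[up [l [k e]]];
  exists up, l, k; [by left|by right].
Qed.

Lemma Qset_tower (K L q : nat) (a b : 'I_q) (v : nat) (s : config K L q) :
  1 < K -> 1 < L -> v < L -> Qset K L a b v s ->
  exists h, 1 <= h <= K - 1 /\ oriented_tower a b (v * K + h) s.
Proof.
move=> K1 L1 vL /QsetE[|[KL]] /(Qtilde_tower K1 L1 vL)[up [l [k [h [hK e]]]]];
  exists h; split=> //; exists up, l, k; [by left|by right].
Qed.

Lemma oriented_two (K L q : nat) (a b : 'I_q) (n : nat) (s : config K L q) :
  oriented_tower a b n s -> forall x, s x = a \/ s x = b.
Proof.
move=> [up [l [k [->|[KL e]]]]] x; first exact: tower_two.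
by subst L; rewrite -(transpK s) e transp_swap; apply: tower_two.
Qed.

Lemma oriented_cnt (K L q : nat) (a b : 'I_q) (n : nat) (s : config K L q) :
  1 < K -> 1 < L -> a != b -> n <= K * L ->
  oriented_tower a b n s -> cnt b s = n.
Proof.
move=> K1 L1 ab nKL [up [l [k [->|[KL e]]]]]; first exact: cnt_tower.
by subst L; rewrite -cnt_transp e cnt_tower.
Qed.

Lemma oriented_cnt2 (K L q : nat) (a b : 'I_q) (n : nat) (s : config K L q) :
  1 < K -> 1 < L -> a != b -> n <= K * L ->
  oriented_tower a b n s -> cnt a s = K * L - n.
Proof.
move=> K1 L1 ab nKL h; have := cnt_two K1 L1 ab (oriented_two h).
by rewrite (oriented_cnt K1 L1 ab nKL h); lia.
Qed.

(** Both phases are at least two full rows thick.  This is how configurations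
    are shown to avoid [BGam]. *)
Lemma BGam_cnt (K L q : nat) (s : config K L q) : 1 < K -> 2 < L ->
  BGam K L q s -> exists a b, [/\ a != b, 2 * K < cnt a s & 2 * K < cnt b s].
Proof.
move=> K1 L2 [[a b] /= ab [v /= /andP[v2 vL] hQ]].
have L1 := ltnW L2.
have vL' : v < L by lia.
have [h [hK ht]] := Qset_tower K1 L1 vL' hQ.
have le : v * K + h <= K * L.
  have : v.+1 * K <= L * K by rewrite leq_mul2r vL' orbT.
  by rewrite mulSn [L * K]mulnC; lia.
exists a, b; split=> //.
  rewrite (oriented_cnt2 K1 L1 ab le ht).
  have : v.+3 * K <= L * K by rewrite leq_mul2r; apply/orP; right; lia.
  by rewrite !mulSn [L * K]mulnC; lia.
rewrite (oriented_cnt K1 L1 ab le ht).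
have : 2 * K <= v * K by rewrite leq_mul2r v2 orbT.
by lia.
Qed.

Lemma step_sym (K L q : nat) : symmetric (@step K L q).
Proof.
by move=> s t; rewrite /step; congr (_ == 1); apply: eq_card => x; rewrite !inE eq_sym.
Qed.

Lemma stepP (K L q : nat) (s t : config K L q) : step s t ->
  exists z, s z != t z /\ forall x, x != z -> s x = t x.
Proof.
move=> /cards1P[z /setP E]; exists z; split.
  by have := E z; rewrite !inE eqxx.
by move=> x xz; have := E x; rewrite !inE (negbTE xz) => /negbFE/eqP.
Qed.

Lemma cnt_step (K L q : nat) (c : 'I_q) (s t : config K L q) :
  step s t -> cnt c s <= (cnt c t).+1.
Proof.
move=> /stepP[z [_ st]]; rewrite /cnt (cardsD1 z).
rewrite -[X in _ <= X]add1n leq_add ?leq_b1 //.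
apply/subset_leq_card/fintype.subsetP => x; rewrite !inE => /andP[xz].
by rewrite st.
Qed.

(** With two colours, a flip exchanges them at one site. *)
Lemma cnt_step_neq (K L q : nat) (a b : 'I_q) (s t : config K L q) :
  a != b -> (forall x, s x = a \/ s x = b) -> (forall x, t x = a \/ t x = b) ->
  step s t -> cnt b s != cnt b t.
Proof.
move=> ab sab tab /stepP[z [nz st]].
rewrite /cnt (cardsD1 z) [X in _ != X](cardsD1 z) !inE.
rewrite [X in _ + X != _](_ : _ = #|[set x | t x == b] :\ z|%SET); last first.
  apply: eq_card => x; rewrite !inE; case: eqP => //= /eqP xz.
  by rewrite st.
rewrite eqn_add2r; move: nz.
by case: (sab z) => ->; case: (tab z) => ->; rewrite ?eqxx // (negbTE ab).
Qed.

(** * Paths *)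

(** Connection by a path all of whose configurations satisfy [P]; it covers
    the height bound and the avoidance of [BGam] at once. *)
Definition reach (K L q : nat) (P : config K L q -> Prop) (s t : config K L q) :
    Prop :=
  exists p, is_path s t p /\ forall u, u \in s :: p -> P u.

Lemma reach_refl (K L q : nat) (P : config K L q -> Prop) (s : config K L q) :
  P s -> reach P s s.
Proof. by move=> Ps; exists [::]; split=> // u; rewrite inE => /eqP->. Qed.

Lemma reach_step (K L q : nat) (P : config K L q -> Prop)
    (s t u : config K L q) :
  reach P s t -> step t u -> P u -> reach P s u.
Proof.
move=> [p [[hp lp] hP]] tu Pu; exists (rcons p u); split.
  by split; rewrite ?last_rcons // rcons_path hp lp.
move=> w; rewrite -rcons_cons mem_rcons inE => /orP[/eqP->//|].
exact: hP.
Qed.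

Lemma reach_ind (K L q : nat) (P I : config K L q -> Prop) (s t : config K L q) :
  (P s -> I s) ->
  (forall u w, reach P s u -> I u -> step u w -> P u -> P w -> I w) ->
  reach P s t -> I t.
Proof.
move=> Is Istep [p [[hp <-] hP]] {t}.
elim/last_ind: p hp hP => [|p u IH] /= hp hP.
  by apply: Is; apply: hP; rewrite inE.
rewrite rcons_path in hp; case/andP: hp => hp hl.
have hP' w : w \in s :: p -> P w.
  by move=> wp; apply: hP; rewrite -rcons_cons mem_rcons inE wp orbT.
rewrite last_rcons; apply: Istep hl _ _; last 2 first.
- by apply: hP'; apply: mem_last.
- by apply: hP; rewrite -rcons_cons mem_rcons inE eqxx.
- by exists p.
- exact: IH.
Qed.

Lemma reach_end (K L q : nat) (P : config K L q -> Prop) (s t : config K L q) :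
  reach P s t -> P t.
Proof. by apply: reach_ind. Qed.

Lemma reach_mono (K L q : nat) (P P' : config K L q -> Prop)
    (s t : config K L q) :
  (forall u, P u -> P' u) -> reach P s t -> reach P' s t.
Proof. by move=> h [p [hp hP]]; exists p; split=> // u /hP/h. Qed.

Lemma reach_transp (K q : nat) (P : config K K q -> Prop) (s t : config K K q) :
  (forall u, P u -> P (transp u)) -> reach P s t ->
  reach P (transp s) (transp t).
Proof.
move=> hP.
apply: (reach_ind (I := fun u => reach P (transp s) (transp u))) => [Ps|u w _ hu uw _ Pw].
  by apply: reach_refl; apply: hP.
by apply: reach_step hu _ (hP _ Pw); rewrite step_transp.
Qed.

Lemma heightP (K L q : nat) (s : config K L q) (p : seq (config K L q)) (m : nat) :
  height s p <= m <-> forall u, u \in s :: p -> H u <= m.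
Proof.
rewrite /height; split=> [/bigmax_leqP_seq h u up|h]; first exact: h.
by apply/bigmax_leqP_seq => u up _; apply: h.
Qed.

Lemma NhatE (K L q : nat) (s t : config K L q) :
  Nhat s t <-> reach (fun u => H u <= Gam K) s t.
Proof.
rewrite /Nhat /= /Phi; case: ex_minnP => m /asboolP[p [hp hm]] mmin; split.
  by move=> le; exists p; split=> //; apply/heightP; rewrite hm.
move=> [p' [hp' /heightP le]]; apply: leq_trans le.
by apply: mmin; apply/asboolP; exists p'.
Qed.

Definition admissible (K L q : nat) (u : config K L q) : Prop :=
  H u <= Gam K /\ ~ BGam K L q u.

Lemma EspinE (K L q : nat) (a : 'I_q) (t : config K L q) :
  Espin K L a t <-> reach (@admissible K L q) (mono K L a) t.
Proof.
split=> [[p [hp av /heightP hH]]|[p [hp hP]]].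
  by exists p; split=> // u up; split; [apply: hH|apply: av].
exists p; split=> //; first by move=> u /hP[].
by apply/heightP => u /hP[].
Qed.

Lemma reach_tower (K L q : nat) (P : config K L q -> Prop) (a b : 'I_q)
    (up : bool) (l : 'Z_L) (k : 'Z_K) (n : nat) :
  1 < K -> 1 < L -> a != b -> n <= K * L ->
  (forall m, m <= n -> P (tower a b up l k m)) ->
  reach P (mono K L a) (tower a b up l k n).
Proof.
move=> K1 L1 ab; elim: n => [|n IH] nKL hP.
  by rewrite tower0; apply: reach_refl; rewrite -(tower0 a b up l k); apply: hP.
apply: (@reach_step _ _ _ _ _ (tower a b up l k n)).
- by apply: IH => [|m mn]; [apply: ltnW|apply: hP; apply: leqW].
- exact: step_tower.
- exact: hP.
Qed.

(** * A critical number of spins forces a strip with a bar *)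

(** As the count is 1 modulo K, not every row can be full of [a] or free of
    [a]; a mixed row exhausts the budget for rows, so the row free of [a] is
    monochromatic and the classification of configurations with two full rows
    applies.  The count then determines the width. *)
Lemma critical_rows (K L q : nat) (s : config K L q) (a : 'I_q) (t : nat)
    (y1 y2 : 'Z_L) :
  2 < K -> 2 < L -> H s <= Gam K -> 1 <= t <= L - 3 ->
  cnt a s = K * L - (K * t + 1) ->
  (forall x, s (x, y1) = a) -> (forall x, s (x, y2) != a) ->
  exists b, a != b /\ Qtilde K L a b t s.
Proof.
move=> K2 L2 Hs tb ca sa sna; have K1 := ltnW K2; have L1 := ltnW L2.
have tKL : K * t + 3 * K <= K * L.
  have : K * (t + 3) <= K * L by rewrite leq_mul2l; apply/orP; right; lia.
  by rewrite mulnDr; lia.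
have ne x : s (x, y1) != s (x, y2) by rewrite sa eq_sym.
have [j [x0 [ej cj]]] : exists j x, s (x, j) = a /\ 1 < ncuts (hslice s j).
  have [/existsP[j /existsP[x /existsP[x' /andP[/eqP e e']]]]|] :=
      boolP [exists y, exists x, exists x', (s (x, y) == a) && (s (x', y) != a)].
    exists j, x; split=> //.
    by apply: (@cuts_ge2 _ _ _ x x'); rewrite /hslice e eq_sym.
  move=> /existsPn none; exfalso.
  have same x y : (s (x, y) == a) = (s (0%R, y) == a).
    have /existsPn h := none y; apply/idP/idP => hx.
      by have /existsPn/(_ 0%R) := h x; rewrite hx negbK.
    by have /existsPn/(_ x) := h 0%R; rewrite hx negbK.
  move: ca; rewrite /cnt (_ : [set x | _]%SET =
     finset.setX [set: 'Z_K]%SET [set y | s (0%R, y) == a]%SET); last first.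
    by apply/setP => -[x y]; rewrite !inE same.
  rewrite cardsX cardsT card_Zp_type // => e.
  have : K %| K * L - (K * t + 1) by rewrite -e dvdn_mulr.
  rewrite dvdn_subr ?dvdn_mulr //; last lia.
  by rewrite dvdn_addr ?dvdn_mulr // dvdn1; lia.
have y2j : y2 != j by apply: contraNneq (sna x0) => ->; rewrite ej.
have rc := other_rows_const K2 L2 Hs ne cj y2j.
pose b := s (0%R, y2); have ab : a != b by rewrite eq_sym sna.
exists b; split=> //.
have cs n up l k : n <= K * L -> s = tower a b up l k n -> n = K * t + 1.
  move=> nKL e; have st : oriented_tower a b n s by exists up, l, k; left.
  by have := oriented_cnt2 K1 L1 ab nKL st; rewrite ca; lia.
case: (full_rows_strip K2 L2 ab Hs sa (rc^~ 0%R)) => -[v [vb hv]].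
  have vL : v <= L by lia.
  have [up [l [k e]]] := Rtilde_tower K1 L1 vL hv.
  have := cs _ _ _ _ _ e; rewrite [K * L]mulnC leq_mul2r vL orbT => /(_ isT) h.
  have : K %| K * t + 1 by rewrite -h dvdn_mull.
  by rewrite dvdn_addr ?dvdn_mulr // dvdn1; lia.
have vL : v < L by lia.
have [up [l [k [h [hb e]]]]] := Qtilde_tower K1 L1 vL hv.
have le : v * K + h <= K * L.
  have : v.+1 * K <= L * K by rewrite leq_mul2r vL orbT.
  by rewrite mulSn [L * K]mulnC; lia.
have E := cs _ _ _ _ le e.
suff -> : t = v by [].
have := congr1 (divn^~ K) E; rewrite [K * t]mulnC /= !divnMDl; try lia.
by rewrite !divn_small; lia.
Qed.

Definition mixed_rows (K L q : nat) (a : 'I_q) (s : config K L q) : {set 'Z_L} :=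
  [set y | [exists x, s (x, y) == a] && [exists x, s (x, y) != a]]%SET.

Definition mixed_cols (K L q : nat) (a : 'I_q) (s : config K L q) : {set 'Z_K} :=
  [set x | [exists y, s (x, y) == a] && [exists y, s (x, y) != a]]%SET.

Lemma sum_ge2_on (I : finType) (A : {set I}) (F : I -> nat) :
  (forall i, i \in A -> 1 < F i) -> 2 * #|A| <= \sum_i F i.
Proof.
move=> h; rewrite mulnC -sum_nat_const big_mkcond.
by apply: leq_sum => i _; case: ifP => // /h.
Qed.

Lemma mixed_bound (K L q : nat) (a : 'I_q) (s : config K L q) :
  2 < K -> 2 < L -> H s <= Gam K -> #|mixed_rows a s| + #|mixed_cols a s| <= K.+1.
Proof.
move=> K2 L2; rewrite energy_lines // /Gam => Hs.
have hr : 2 * #|mixed_rows a s| <= \sum_y ncuts (hslice s y).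
  apply: sum_ge2_on => y; rewrite inE => /andP[/existsP[x /eqP e] /existsP[x']].
  by rewrite -e => h; apply: (@cuts_ge2 _ _ _ x x'); rewrite eq_sym.
have hc : 2 * #|mixed_cols a s| <= \sum_x ncuts (vslice s x).
  apply: sum_ge2_on => y; rewrite inE => /andP[/existsP[x /eqP e] /existsP[x']].
  by rewrite -e => h; apply: (@cuts_ge2 _ _ _ x x'); rewrite eq_sym.
by have := leq_trans (leq_add hc hr) Hs; lia.
Qed.

Lemma box_bound (K L q : nat) (a : 'I_q) (s : config K L q)
    (P : pred (site K L)) :
  (forall x y, P (x, y) -> x \in mixed_cols a s /\ y \in mixed_rows a s) ->
  #|[set p | P p]%SET| <= #|mixed_cols a s| * #|mixed_rows a s|.
Proof.
move=> h; rewrite -cardsX; apply/subset_leq_card/fintype.subsetP => -[x y].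
by rewrite !inE /= => /h[]; rewrite !inE => -> ->.
Qed.

(** If both kinds of unmixed rows occur, [critical_rows] applies.  If
    both kinds of unmixed columns occur, all L rows are mixed, so that
    L <= K + 1; the case L = K follows by transposition, and L = K + 1 leaves
    no mixed column, which makes the number of spins [a] a multiple of L.
    Otherwise all unmixed lines are of the same kind, and
    one of the two phases is confined to the product of the mixed lines,
    which is too small. *)
Lemma critical_BGam (K L q : nat) (s : config K L q) (a : 'I_q) (t : nat) :
  10 < K <= L -> H s <= Gam K -> 2 * t + 2 <= K <= 2 * t + 3 ->
  cnt a s = K * L - (K * t + 1) -> BGam K L q s.
Proof.
move=> /andP[K10 KL] Hs tK ca.
have K2 : 2 < K by lia.
have L2 : 2 < L by lia.
have K1 := ltnW K2; have L1 := ltnW L2.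
have tb : 1 <= t <= L - 3 by lia.
have tb' : 2 <= t <= L - 3 by lia.
have tKL : K * t + 3 * K <= K * L.
  have : K * (t + 3) <= K * L by rewrite leq_mul2l; apply/orP; right; lia.
  by rewrite mulnDr; lia.
have finish b : a != b -> Qset K L a b t s -> BGam K L q s.
  by move=> ab hQ; exists (a, b) => //; exists t.
have rc := mixed_bound a K2 L2 Hs.
have box : 4 * (#|mixed_cols a s| * #|mixed_rows a s|) <= K * K + 2 * K + 1.
  apply: leq_trans (nat_AGM2 _ _) _; rewrite addnC.
  have -> : K * K + 2 * K + 1 = K.+1 ^ 2 by rewrite -mulnn mulSn mulnS; lia.
  by rewrite leq_sqr.
have KK : 11 * K <= K * K by rewrite leq_mul2r K10 orbT.
have KKL : K * K <= K * L by rewrite leq_mul2l KL orbT.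
have tlo : K * K <= 2 * (K * t) + 3 * K.
  have : K * K <= K * (2 * t + 3) by rewrite leq_mul2l; apply/orP; right; lia.
  by rewrite mulnDr mulnCA; lia.
have thi : 2 * (K * t) + 2 * K <= K * K.
  have : K * (2 * t + 2) <= K * K by rewrite leq_mul2l; apply/orP; right; lia.
  by rewrite mulnDr mulnCA; lia.
have cna : #|[set p | s p != a]%SET| = K * t + 1.
  have := cardsC [set p | s p == a]%SET; rewrite card_site // -/(cnt a s) ca.
  rewrite (_ : ~: _ = [set p | s p != a])%SET; first by lia.
  by apply/setP => p; rewrite !inE.
have nobox1 : ~ (forall x y, s (x, y) != a ->
    x \in mixed_cols a s /\ y \in mixed_rows a s).
  by move=> /(@box_bound _ _ _ a s (fun p => s p != a)); rewrite cna; lia.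
have nobox2 : ~ (forall x y, s (x, y) == a ->
    x \in mixed_cols a s /\ y \in mixed_rows a s).
  move=> /(@box_bound _ _ _ a s (fun p => s p == a)); rewrite -/(cnt a s) ca.
  by lia.
have [/existsP[y1 /forallP ra]|/existsPn nra] :=
  boolP [exists y, forall x, s (x, y) == a].
  have [/existsP[y2 /forallP rn]|/existsPn nrn] :=
  boolP [exists y, forall x, s (x, y) != a].
    have [b [ab hQ]] := critical_rows K2 L2 Hs tb ca (fun x => eqP (ra x)) rn.
    by apply: (finish b ab); apply/QsetE; left.
  case: nobox1 => x y sxy; rewrite !inE; split; apply/andP; split.
  - by apply/existsP; exists y1.
  - by apply/existsP; exists y.
  - have := nrn y; rewrite negb_forall => /existsP[x' hx]; apply/existsP; exists x'.
    by rewrite negbK in hx.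
  - by apply/existsP; exists x.
have [/existsP[x1 /forallP cA]|/existsPn ncA] :=
  boolP [exists x, forall y, s (x, y) == a].
  have [/existsP[x2 /forallP cn]|/existsPn ncn] :=
  boolP [exists x, forall y, s (x, y) != a].
    have hr : #|mixed_rows a s| = L.
      rewrite -[RHS](card_Zp_type L1) -cardsT; congr #|pred_of_set _|.
      apply/setP => y; rewrite !inE; apply/andP.
      by split; apply/existsP; [exists x1|exists x2].
    have [KL'|KL'] := eqVneq K L.
      subst L; have Hs' : H (transp s) <= Gam K by rewrite energy_transp.
      have ca' : cnt a (transp s) = K * K - (K * t + 1) by rewrite cnt_transp.
      have [|x|b [ab hQ]] := critical_rows K2 L2 Hs' tb ca' (y1 := x1) (y2 := x2).
      - by move=> x; rewrite transp_app; apply/eqP.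
      - by rewrite transp_app.
      by apply: (finish b ab); apply/QsetE; right.
    have LK : L = K.+1 by lia.
    have /cards0_eq C0 : #|mixed_cols a s| = 0 by lia.
    have same x y : (s (x, y) == a) = (s (x, 0%R) == a).
      have := finset.in_set0 x; rewrite -C0 inE => /negbT.
      rewrite negb_and !negb_exists => /orP[]/forallP h.
        by rewrite (negbTE (h y)) (negbTE (h 0%R)).
      by have := h y; have := h 0%R; rewrite !negbK => -> ->.
    move: ca; rewrite /cnt (_ : [set x | _]%SET =
       finset.setX [set x | s (x, 0%R) == a]%SET [set: 'Z_L]%SET); last first.
      by apply/setP => -[x y]; rewrite !inE same andbT.
    rewrite cardsX cardsT card_Zp_type // => e.
    have : L %| K * L - (K * t + 1) by rewrite -e dvdn_mull.
    rewrite dvdn_subr ?dvdn_mull //; last lia.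
    (* Modulo L = K + 1 the count is 1 - t, which is not 0. *)
    have -> : K * t + 1 = L * t - (t - 1) by rewrite LK mulSn; lia.
    rewrite dvdn_subr ?dvdn_mulr //; last by rewrite LK mulSn; lia.
    by move=> /dvdn_leq; lia.
  case: nobox1 => x y sxy; rewrite !inE; split; apply/andP; split.
  - have := ncn x; rewrite negb_forall => /existsP[x' hx]; apply/existsP; exists x'.
    by rewrite negbK in hx.
  - by apply/existsP; exists y.
  - by apply/existsP; exists x1.
  - by apply/existsP; exists x.
case: nobox2 => x y sxy; rewrite !inE; split; apply/andP; split.
- by apply/existsP; exists y.
- by have := ncA x; rewrite negb_forall.
- by apply/existsP; exists x.
- by have := nra y; rewrite negb_forall.
Qed.

(** * Valleys and their neighbours *)

Lemma cnt_mono (K L q : nat) (a : 'I_q) : 1 < K -> 1 < L ->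
  cnt a (mono K L a) = K * L.
Proof.
move=> K1 L1; rewrite -card_site // -[in RHS]cardsT; apply: eq_card => x.
by rewrite !inE ffunE eqxx.
Qed.

Lemma cnt_mono_other (K L q : nat) (a b : 'I_q) :
  b != a -> cnt b (mono K L a) = 0.
Proof.
by move=> ba; apply: eq_card0 => x; rewrite !inE ffunE eq_sym; apply/negbTE.
Qed.

(** The number of spins [a] starts from K L and cannot jump over the critical
    value, which is attained only in [BGam]. *)
Lemma Espin_cnt (K L q : nat) (a : 'I_q) (t : nat) (s : config K L q) :
  10 < K <= L -> 2 * t + 2 <= K <= 2 * t + 3 -> Espin K L a s ->
  K * L - (K * t + 1) < cnt a s.
Proof.
move=> KL tK /EspinE; have /andP[K10 KL'] := KL.
have K1 : 1 < K by lia.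
have L1 : 1 < L by lia.
apply: (reach_ind (I := fun u => _ < cnt a u)) => [_|u w _ hu uw _ [Hw nw]].
  by rewrite cnt_mono // ltn_subrL addn1 /= muln_gt0; lia.
have := cnt_step a uw => le.
have [e|ne] := eqVneq (cnt a w) (K * L - (K * t + 1)); last by lia.
by case: nw; apply: critical_BGam KL Hw tK e.
Qed.

(** Both colours would occupy more than half of the torus. *)
Lemma Espin_disjoint (K L q : nat) (a b : 'I_q) (s : config K L q) :
  10 < K <= L -> a != b -> Espin K L a s -> Espin K L b s -> False.
Proof.
move=> KL ab ha hb; have /andP[K10 KL'] := KL.
have K1 : 1 < K by lia.
have L1 : 1 < L by lia.
(* With this width the critical count is at most half of the torus. *)
have tK : 2 * (K %/ 2 - 1) + 2 <= K <= 2 * (K %/ 2 - 1) + 3.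
  by clear - K10; lia.
have := Espin_cnt KL tK ha; have := Espin_cnt KL tK hb.
have := cnt_le s K1 L1 ab; set t := K %/ 2 - 1 in tK *.
have : K * K <= K * L by rewrite leq_mul2l KL' orbT.
have : K * (2 * t + 2) <= K * K by rewrite leq_mul2l; apply/orP; right; lia.
by rewrite mulnDr mulnCA; move: (K * t) (K * K) (K * L) => A B C; lia.
Qed.

Lemma admissible_cnt (K L q : nat) (a : 'I_q) (s : config K L q) :
  10 < K <= L -> H s <= Gam K -> (forall c, c != a -> cnt c s <= 2 * K) ->
  admissible s.
Proof.
move=> KL Hs hc; split=> // hB.
have K1 : 1 < K by lia.
have L2 : 2 < L by lia.
have [b [c [bc hb hc']]] := BGam_cnt K1 L2 hB.
have [e|ne] := eqVneq b a; last by have := hc _ ne; lia.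
have ca : c != a by rewrite -e eq_sym.
by have := hc _ ca; lia.
Qed.

Lemma energy_mono (K L q : nat) (a : 'I_q) : 2 < K -> 2 < L ->
  H (mono K L a) = 0.
Proof.
move=> K2 L2; rewrite energy_lines //.
by rewrite !big1 // => i _; apply: cuts_const => x y; rewrite /hslice /vslice !ffunE.
Qed.

Lemma mono_Espin (K L q : nat) (a : 'I_q) : 10 < K <= L ->
  Espin K L a (mono K L a).
Proof.
move=> KL; apply/EspinE; apply: reach_refl; apply: (admissible_cnt (a := a)) => //.
  by rewrite energy_mono //; lia.
by move=> c ca; rewrite cnt_mono_other.
Qed.

Lemma oriented_transp (K q : nat) (a b : 'I_q) (n : nat) (s : config K K q) :
  oriented_tower a b n s -> oriented_tower a b n (transp s).
Proof.
move=> [up [l [k [e|[_ e]]]]]; exists up, l, k; [right|by left].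
by rewrite transpK.
Qed.

Lemma oriented_reach (K L q : nat) (a b : 'I_q) (n : nat) (s : config K L q) :
  1 < K -> 1 < L -> a != b -> n <= K * L -> oriented_tower a b n s ->
  reach (fun u => exists m, m <= n /\ oriented_tower a b m u) (mono K L a) s.
Proof.
move=> K1 L1 ab nKL [up [l [k [->|[KL e]]]]].
  apply: reach_tower => // m mn; exists m; split=> //.
  by exists up, l, k; left.
subst L; rewrite -(transpK s) e -(transp_mono K a).
apply: reach_transp => [u [m [mn hm]]|].
  by exists m; split=> //; apply: oriented_transp.
apply: reach_tower => // m mn; exists m; split=> //.
by exists up, l, k; left.
Qed.

Lemma energy_oriented (K L q : nat) (a b : 'I_q) (n : nat) (s : config K L q) :
  2 < K -> 2 < L -> oriented_tower a b n s -> H s <= Gam K.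
Proof.
move=> K2 L2 [up [l [k [->|[KL e]]]]]; first exact: energy_tower.
by subst L; rewrite -energy_transp // e energy_tower.
Qed.

(** The filling path to a strip of width 2 never contains more than 2K spins of
    the new colour. *)
Lemma R2_Espin (K L q : nat) (a b : 'I_q) (s : config K L q) :
  10 < K <= L -> a != b -> Rset K L a b 2 s -> Espin K L a s.
Proof.
move=> KL ab hR; have /andP[K10 KL'] := KL.
have K2 : 2 < K by lia.
have L2 : 2 < L by lia.
have K1 := ltnW K2; have L1 := ltnW L2.
have le : 2 * K <= K * L by rewrite mulnC leq_mul2l; lia.
have := oriented_reach K1 L1 ab le (Rset_tower K1 L1 L1 hR).
move=> h; apply/EspinE; apply: reach_mono h => u [m [m2 hm]].
have mKL := leq_trans m2 le.
apply: (admissible_cnt (a := a)) => //; first exact: energy_oriented hm.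
move=> c ca; have [->|cb] := eqVneq c b.
  by rewrite (oriented_cnt K1 L1 ab mKL hm).
by rewrite (cnt_other (oriented_two hm)).
Qed.

Lemma Bpair_tower (K L q : nat) (a b : 'I_q) (s : config K L q) :
  10 < K <= L -> Bpair K L a b s ->
  exists n, 2 * K <= n <= (L - 2) * K /\ oriented_tower a b n s.
Proof.
move=> /andP[K10 KL].
have K2 : 2 < K by lia.
have L2 : 2 < L by lia.
have K1 := ltnW K2; have L1 := ltnW L2.
case=> -[v /= /andP[v2 vL] hs].
  have vL' : v <= L by lia.
  exists (v * K); split; last exact: Rset_tower.
  by rewrite !leq_mul2r v2 vL !orbT.
have vL' : v < L by lia.
have [h [hb ht]] := Qset_tower K1 L1 vL' hs.
exists (v * K + h); split=> //; apply/andP; split.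
  have : 2 * K <= v * K by rewrite leq_mul2r v2 orbT.
  by lia.
have : v.+1 * K <= (L - 2) * K by rewrite leq_mul2r; apply/orP; right; lia.
by rewrite mulSn; lia.
Qed.

Lemma Rset_swap_spins (K L q : nat) (a b : 'I_q) (v : nat) (s : config K L q) :
  1 < K -> 1 < L -> 0 < v < L -> Rset K L a b v s -> Rset K L b a (L - v) s.
Proof.
move=> K1 L1 vL; have flip u : Rtilde K L a b v u -> Rtilde K L b a (L - v) u.
  move=> [l ->]; exists (l + v%:R)%R; apply/ffunP => -[x y].
  rewrite !ffunE !arc_val //; try lia.
  rewrite -[(x, y).2]/y opprD addrA (val_subZp (y - l)%R v%:R%R L1) val_natZp //;
    last lia.
  have := Zp_lt (y - l)%R L1; move: (nat_of_ord (y - l)%R) => t tL.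
  by case: (leqP v t) => h1; case: ifP => h2 //; exfalso; lia.
by move=> /RsetE[|[KL]] /flip h; apply/RsetE; [left|right].
Qed.

(** Two full rows of each colour, at the bottom and at the top of the
    filling order, are present; a flip spoils at most one of the two, so the
    flipped configuration still has a full row of each colour. *)
Lemma tower_neighbour (K L q : nat) (a b : 'I_q) (up : bool) (l : 'Z_L)
    (k : 'Z_K) (n : nat) (t : config K L q) :
  2 < K -> 3 < L -> a != b -> 2 * K <= n <= (L - 2) * K ->
  step (tower a b up l k n) t -> H t <= Gam K ->
  (exists v, 1 <= v <= L - 1 /\ Rtilde K L a b v t) \/
  (exists v, 1 <= v <= L - 2 /\ Qtilde K L a b v t).
Proof.
move=> K2 L3 ab /andP[n2 nL] /stepP[z [_ st]] Ht.
have K1 := ltnW K2; have L2 := ltnW L3; have L1 := ltnW L2.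
pose y i := (if up then l + i%:R else l - i%:R)%R : 'Z_L.
have rk i x : i < L -> fill_rank up l k (x, y i) = i * K + (x - k)%R.
  move=> iL; rewrite /fill_rank -[(x, y i).1]/x -[(x, y i).2]/(y i).
  have -> : (if up then y i - l else l - y i)%R = i%:R%R.
    by rewrite /y; case: (up); [rewrite addrC addKr | rewrite opprB addrC subrK].
  by rewrite val_natZp.
have yinj i j : i < L -> j < L -> y i = y j -> i = j.
  move=> iL jL; rewrite /y => e.
  have : (i%:R : 'Z_L)%R = j%:R%R by move: e; case: (up) => [/addrI|/addrI/oppr_inj].
  by move=> /(congr1 (@nat_of_ord _)); rewrite !val_natZp.
have keep i j c : i < L -> j < L -> i != j ->
    (forall x, tower a b up l k n (x, y i) = c) ->
    (forall x, tower a b up l k n (x, y j) = c) ->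
    exists y', forall x, t (x, y') = c.
  move=> iL jL ij hi hj; have [zi|zi] := eqVneq z.2 (y i).
    exists (y j) => x; rewrite -st ?hj //; apply: contra_neq ij => e.
    by apply: yinj => //; rewrite -zi -e.
  by exists (y i) => x; rewrite -st ?hi //; apply: contra_neq zi => <-.
have lx (x : 'Z_K) := Zp_lt (x - k)%R K1.
have [y1 h1] : exists y', forall x, t (x, y') = a.
  apply: (keep (L - 2) (L - 1)); try lia; move=> x; rewrite ffunE rk ?ifF //; try lia;
    by apply/negbTE; rewrite -leqNgt (leq_trans nL) // (leq_trans _ (leq_addr _ _)) //
       leq_mul2r; apply/orP; right; lia.
have [y2 h2] : exists y', forall x, t (x, y') = b.
  by apply: (keep 0 1); try lia; move=> x; rewrite ffunE rk ?ifT //; have := lx x; lia.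
exact: full_rows_strip h1 h2.
Qed.

Lemma Bpair_neighbour (K L q : nat) (a b : 'I_q) (s t : config K L q) :
  10 < K <= L -> a != b -> Bpair K L a b s -> step s t -> H t <= Gam K ->
  (exists v, 1 <= v <= L - 1 /\ Rset K L a b v t) \/
  (exists v, 1 <= v <= L - 2 /\ Qset K L a b v t).
Proof.
move=> KL ab /(Bpair_tower KL)[n [nb [up [l [k hs]]]]] st Ht.
have K2 : 2 < K by lia.
have L3 : 3 < L by lia.
case: hs => [e|[KL' e]].
  rewrite e in st; case: (tower_neighbour K2 L3 ab nb st Ht) => -[v [vb hv]].
    by left; exists v; split=> //; apply/RsetE; left.
  by right; exists v; split=> //; apply/QsetE; left.
subst L; rewrite -step_transp e in st; rewrite -energy_transp // in Ht.
case: (tower_neighbour K2 L3 ab nb st Ht) => -[v [vb hv]].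
  by left; exists v; split=> //; apply/RsetE; right.
by right; exists v; split=> //; apply/QsetE; right.
Qed.

(** The number of spins [b] is a multiple of K and changes by exactly one, so
    the flipped configuration is not a strip; it is a strip of width v - 1 or
    v with a bar, and both widths are in the range of [BGam]. *)
Lemma R_isolated (K L q : nat) (a b : 'I_q) (v : nat) (s t : config K L q) :
  10 < K <= L -> a != b -> 3 <= v <= L - 3 -> Rset K L a b v s -> step s t ->
  H t <= Gam K -> BGam K L q t.
Proof.
move=> KL ab vb hs st Ht; have /andP[K10 KL'] := KL.
have K2 : 2 < K by lia.
have L2 : 2 < L by lia.
have K1 := ltnW K2; have L1 := ltnW L2.
have vL : v <= L by lia.
have hB : Bpair K L a b s by left; exists v => //=; lia.
have os := Rset_tower K1 L1 vL hs.
have le w : w <= L -> w * K <= K * L by move=> wL; rewrite mulnC leq_mul2l wL orbT.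
have cs := oriented_cnt K1 L1 ab (le _ vL) os.
have c1 := cnt_step b st; have c2 : cnt b t <= (cnt b s).+1.
  by apply: cnt_step; rewrite step_sym.
case: (Bpair_neighbour KL ab hB st Ht) => -[w [wb hw]].
  have wL : w <= L by lia.
  have ot := Rset_tower K1 L1 wL hw.
  have := cnt_step_neq ab (oriented_two os) (oriented_two ot) st.
  rewrite cs in c1 c2 *; rewrite (oriented_cnt K1 L1 ab (le _ wL) ot) in c1 c2 *.
  move=> ne; exfalso; case: (ltngtP v w) ne => [vw _|vw _|->]; last by rewrite eqxx.
    have : v.+1 * K <= w * K by rewrite leq_mul2r vw orbT.
    by rewrite mulSn; lia.
  have : w.+1 * K <= v * K by rewrite leq_mul2r vw orbT.
  by rewrite mulSn; lia.
have wL : w < L by lia.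
have [h [hb ot]] := Qset_tower K1 L1 wL hw.
have le' : w * K + h <= K * L.
  by have := le _ wL; rewrite mulSn; lia.
rewrite cs (oriented_cnt K1 L1 ab le' ot) in c1 c2.
have w2 : 2 <= w.
  rewrite leqNgt; apply/negP => w1.
  have : w.+2 * K <= v * K by rewrite leq_mul2r; apply/orP; right; lia.
  by rewrite !mulSn; lia.
have w3 : w <= L - 3.
  rewrite leqNgt; apply/negP => w1.
  have : v.+1 * K <= w * K by rewrite leq_mul2r; apply/orP; right; lia.
  by rewrite mulSn; lia.
by exists (a, b) => //; exists w => //=; rewrite w2.
Qed.

(** A path can enter such a strip only from [BGam]. *)
Lemma Espin_middle_strip (K L q : nat) (a b c : 'I_q) (v : nat) (s : config K L q) :
  10 < K <= L -> b != c -> 3 <= v <= L - 3 -> Rset K L b c v s ->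
  Espin K L a s -> False.
Proof.
move=> KL bc vb + /EspinE hs; have /andP[K10 KL'] := KL.
have K1 : 1 < K by lia.
have L1 : 1 < L by lia.
have vL : v <= L by lia.
apply: (reach_ind (I := fun u => Rset K L b c v u -> False)) hs
  => [_|u w _ _ uw [Hu nu] _] hw.
  have os := Rset_tower K1 L1 vL hw.
  have le : v * K <= K * L by rewrite mulnC leq_mul2l vL orbT.
  have lt : v.+1 * K <= K * L by rewrite mulnC leq_mul2l; apply/orP; right; lia.
  have h1 := oriented_cnt K1 L1 bc le os; have h2 := oriented_cnt2 K1 L1 bc le os.
  have v0 : 0 < v * K by rewrite muln_gt0; lia.
  rewrite mulSn in lt.
  have [e|ne] := eqVneq c a.
    have ba : b != a by rewrite -e.
    by rewrite cnt_mono_other // in h2; lia.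
  by rewrite cnt_mono_other // in h1; lia.
by apply: nu; apply: R_isolated KL bc vb hw _ Hu; rewrite step_sym.
Qed.

Lemma Q_BGam (K L q : nat) (a b : 'I_q) (v : nat) (s : config K L q) :
  a != b -> 2 <= v <= L - 3 -> Qset K L a b v s -> BGam K L q s.
Proof. by move=> ab vb hQ; exists (a, b) => //; exists v. Qed.

(** A strip of width L - 2 of [c] in [b] is a strip of width 2 of [b] in [c],
    hence belongs to the valley of [c]. *)
Lemma Espin_Bpair (K L q : nat) (a b c : 'I_q) (s : config K L q) :
  10 < K <= L -> b != c -> Espin K L a s -> Bpair K L b c s ->
  (a = b /\ Rset K L b c 2 s) \/ a = c.
Proof.
move=> KL bc hE; have /andP[K10 KL'] := KL.
have K1 : 1 < K by lia.
have L1 : 1 < L by lia.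
case=> -[v /= vb hs]; last first.
  by have /EspinE/reach_end[_ []] := hE; apply: Q_BGam bc vb hs.
have [v2|v2] := eqVneq v 2.
  rewrite v2 in hs; have [|ab] := eqVneq a b; first by left.
  by case: (Espin_disjoint KL ab hE); apply: R2_Espin hs.
have [vL|vL] := eqVneq v (L - 2).
  right; have vL' : 0 < v < L by lia.
  have := Rset_swap_spins K1 L1 vL' hs; rewrite vL subKn; last lia.
  move=> hR; apply/eqP; apply/negPn/negP => ac.
  by apply: (Espin_disjoint KL ac hE); apply: R2_Espin hR => //; rewrite eq_sym.
have vb' : 3 <= v <= L - 3 by lia.
by case: (Espin_middle_strip KL bc vb' hs hE).
Qed.

(** Strips of width 2 and L - 2 lie in a valley, the strips in between lead
    only to [BGam], and a strip with a bar leads only to canonical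
    configurations of an admissible width. *)
Lemma Nhat_closed (K L q : nat) (s t : config K L q) :
  10 < K <= L -> Eall K L q s \/ Ball K L q s -> step s t -> H t <= Gam K ->
  Eall K L q t \/ Ball K L q t.
Proof.
move=> KL hs st Ht; have /andP[K10 KL'] := KL.
have K1 : 1 < K by lia.
have L1 : 1 < L by lia.
have [hB|nB] := pselect (BGam K L q t).
  by right; case: hB => ab hab [v vb hQ]; exists ab => //; right; exists v.
have hE a : Espin K L a s -> Eall K L q t \/ Ball K L q t.
  move=> /EspinE h; left; exists a => //; apply/EspinE.
  by apply: reach_step h st _; split.
case: hs => [[a _]|[[a b] /= ab hs]]; first exact: hE.
have hB : Bpair K L a b s by [].
case: hs => -[v /= /andP[v2 vL] hs].
  have [e|n2] := eqVneq v 2.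
    by rewrite e in hs; apply: (hE a); apply: R2_Espin hs.
  have [e|nL] := eqVneq v (L - 2).
    have vL' : 0 < v < L by lia.
    have := Rset_swap_spins K1 L1 vL' hs; rewrite e subKn; last lia.
    by move=> hs'; apply: (hE b); apply: R2_Espin hs'; rewrite // eq_sym.
  have vb : 3 <= v <= L - 3 by lia.
  by case: nB; apply: R_isolated KL ab vb hs st Ht.
have vL' : v < L by lia.
have [h [hb os]] := Qset_tower K1 L1 vL' hs.
have lo : 2 * K <= v * K by rewrite leq_mul2r v2 orbT.
have up : v.+1 * K <= (L - 2) * K by rewrite leq_mul2r; apply/orP; right; lia.
have up' : (L - 2) * K <= K * L by rewrite mulnC leq_mul2l; apply/orP; right; lia.
rewrite mulSn in up.
have le : v * K + h <= K * L by lia.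
have := oriented_cnt K1 L1 ab le os => cs.
have c1 := cnt_step b st; have c2 : cnt b t <= (cnt b s).+1.
  by apply: cnt_step; rewrite step_sym.
rewrite cs in c1 c2.
case: (Bpair_neighbour KL ab hB st Ht) => -[w [wb hw]].
  have wL : w <= L by lia.
  have ot := Rset_tower K1 L1 wL hw.
  have le' : w * K <= K * L by rewrite mulnC leq_mul2l wL orbT.
  rewrite (oriented_cnt K1 L1 ab le' ot) in c1 c2.
  right; exists (a, b) => //; left; exists w => //=; apply/andP; split.
    rewrite leqNgt; apply/negP => w1.
    have : w.+1 * K <= 2 * K by rewrite leq_mul2r w1 orbT.
    by rewrite mulSn; lia.
  rewrite leqNgt; apply/negP => w1.
  have : (L - 2).+1 * K <= w * K by rewrite leq_mul2r w1 orbT.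
  by rewrite mulSn; lia.
have wL : w < L by lia.
have [g [gb ot]] := Qset_tower K1 L1 wL hw.
have le' : w * K + g <= K * L.
  have : w.+1 * K <= K * L by rewrite mulnC leq_mul2l wL orbT.
  by rewrite mulSn; lia.
rewrite (oriented_cnt K1 L1 ab le' ot) in c1 c2.
case: nB; apply: Q_BGam ab _ hw; apply/andP; split.
  rewrite leqNgt; apply/negP => w1.
  have : w.+1 * K <= 2 * K by rewrite leq_mul2r w1 orbT.
  by rewrite mulSn; lia.
rewrite leqNgt; apply/negP => w1.
have : (L - 2) * K <= w * K by rewrite leq_mul2r; apply/orP; right; lia.
by lia.
Qed.

Lemma Bpair_sub_Nhat (K L q : nat) (a b : 'I_q) (s : config K L q) :
  10 < K <= L -> a != b -> Bpair K L a b s -> Nhat (mono K L a) s.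
Proof.
move=> KL ab hB; have /andP[K10 KL'] := KL.
have K2 : 2 < K by lia.
have L2 : 2 < L by lia.
have K1 := ltnW K2; have L1 := ltnW L2.
have [n [nb os]] := Bpair_tower KL hB.
have nKL : n <= K * L.
  have : (L - 2) * K <= K * L by rewrite mulnC leq_mul2l; apply/orP; right; lia.
  by lia.
apply/NhatE; apply: reach_mono (oriented_reach K1 L1 ab nKL os) => u [m [_ hm]].
exact: energy_oriented hm.
Qed.

Local Open Scope classical_set_scope.

Theorem proposition6p16 (K L q : nat) (hK : 11 <= K) (hKL : K <= L)
    (hq : 2 <= q) :
  [/\ forall a b : 'I_q, a != b -> Espin K L a `&` Espin K L b = set0,
      forall a b : 'I_q, a != b ->
        Espin K L a `&` Bpair K L a b = Rset K L a b 2,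
      forall a b c : 'I_q, a != b -> b != c -> a != c ->
        Espin K L a `&` Bpair K L b c = set0
    & Eall K L q `|` Ball K L q = Nhat_set (ground K L q)].
Proof.
have KL : 10 < K <= L by rewrite hK hKL.
split.
- move=> a b ab; apply/seteqP; split=> // s [ha hb].
  exact: Espin_disjoint KL ab ha hb.
- move=> a b ab; apply/seteqP; split=> s.
    move=> [ha hB]; case: (Espin_Bpair KL ab ha hB) => [[]//|e].
    by rewrite e eqxx in ab.
  move=> hR; split; first exact: R2_Espin hR.
  by left; exists 2 => //=; lia.
- move=> a b c ab bc ac; apply/seteqP; split=> // s [ha hB].
  case: (Espin_Bpair KL bc ha hB) => [[e _]|e].
    by rewrite e eqxx in ab.
  by rewrite e eqxx in ac.
apply/seteqP; split=> s.
  case=> [[a _ /EspinE h]|[[a b] /= ab hB]].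
    exists (mono K L a); first by exists a.
    by apply/NhatE; apply: reach_mono h => u [].
  by exists (mono K L a); [exists a|apply: Bpair_sub_Nhat hB].
move=> [_ [a _ <-]] /NhatE.
apply: (reach_ind (I := fun u => Eall K L q u \/ Ball K L q u)) => [_|u w _ hu uw _ Hw].
  by left; exists a => //; apply: mono_Espin.
exact: Nhat_closed KL hu uw Hw.
Qed.
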